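(* For every constant $c>0$, the following problem is decidable in polynomial time: given a formula $F = G \wedge C_1 \wedge \dots \wedge C_r$ on $n$ variables, where $G$ is a 2-CNF and $C_1,\dots,C_r$ are $r \le c\log n$ clauses of arbitrary width, decide whether $F$ has at least $2^{n-1}$ satisfying assignments.
   Context: A 2-CNF is a conjunction of clauses (disjunctions of literals) each containing at most two literals. *)

(* Defs.v *)
From HB Require Import structures.
From mathcomp Require Import all_boot all_order all_algebra.
From mathcomp Require Import reals exp.

Set Implicit Arguments.
Unset Strict Implicit.
Unset Printing Implicit Defensive.

Import Order.TTheory GRing.Theory Num.Theory.

Inductive move := MoveL | MoveR | Stay.

(* A two-way infinite tape: [left_of] lists the cells to the left of the head
   (nearest first), [right_of] those to the right (nearest first); every cell
   that is not listed is blank ([None]). *)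
Record tape (A : Type) := Tape {
  left_of : seq (option A);
  scanned : option A;
  right_of : seq (option A)
}.

Definition move_head A (d : move) (t : tape A) : tape A :=
  let: Tape l x r := t in
  match d with
  | MoveL => Tape (behead l) (head None l) (x :: r)
  | MoveR => Tape (x :: l) (head None r) (behead r)
  | Stay => t
  end.

Definition write_cell A (x : option A) (t : tape A) : tape A :=
  Tape (left_of t) x (right_of t).

(* [Sigma] is the input alphabet, [work] the auxiliary tape symbols; a tape
   cell is blank ([None]), an input symbol ([Some (inl a)]) or an auxiliary
   symbol ([Some (inr b)]).  There are [tapes.+1] tapes, tape [ord0] being the
   one that carries the input.  [verdict q] is [None] when [q] is not a halting
   state, [Some true] when it accepts, [Some false] when it rejects. *)
Record TM (Sigma : finType) := MkTM {
  tapes : nat;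
  state : finType;
  work : finType;
  start : state;
  verdict : state -> option bool;
  delta : state -> {ffun 'I_tapes.+1 -> option (Sigma + work)} ->
          state * {ffun 'I_tapes.+1 -> option (Sigma + work) * move}
}.

Section Run.
Variables (Sigma : finType) (M : TM Sigma).

Record config := Config {
  cstate : state M;
  ctapes : 'I_(tapes M).+1 -> tape (Sigma + work M)
}.

Definition step (c : config) : config :=
  if verdict (cstate c) is Some _ then c else
  let: (q, act) :=
    delta (cstate c) [ffun i => scanned (ctapes c i)] in
  Config q (fun i => move_head (act i).2 (write_cell (act i).1 (ctapes c i))).

Definition input_tape (w : seq Sigma) : tape (Sigma + work M) :=
  let cells := [seq Some (inl a) | a <- w] in
  Tape [::] (head None cells) (behead cells).

Definition blank_tape : tape (Sigma + work M) := Tape [::] None [::].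

Definition init (w : seq Sigma) : config :=
  Config (start M) (fun i => if i == ord0 then input_tape w else blank_tape).

Definition answers_within (w : seq Sigma) (t : nat) (b : bool) : Prop :=
  verdict (cstate (iter t step (init w))) = Some b.

End Run.

(* Polynomial-time decidability of a problem whose instances [x : I], given to
   the machine as the words [enc x], are restricted to those satisfying
   [promise]: nothing is required of the machine on other words. *)
Definition poly_time_decidable (I : Type) (Sigma : finType)
    (enc : I -> seq Sigma) (promise : I -> Prop) (yes : I -> bool) : Prop :=
  exists (M : TM Sigma) (k : nat), forall x : I, promise x ->
    answers_within M (enc x) (size (enc x) ^ k + k) (yes x).

(* [(i, true)] is the variable [x_i] and [(i, false)] its negation. *)
Definition literal (n : nat) : Type := ('I_n * bool)%type.
Definition clause (n : nat) : Type := seq (literal n).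
Definition cnf (n : nat) : Type := seq (clause n).

Definition sat_literal n (a : {ffun 'I_n -> bool}) (l : literal n) : bool :=
  a l.1 == l.2.
Definition sat_clause n (a : {ffun 'I_n -> bool}) (C : clause n) : bool :=
  has (sat_literal a) C.
Definition sat_cnf n (a : {ffun 'I_n -> bool}) (F : cnf n) : bool :=
  all (sat_clause a) F.

Definition num_sat n (F : cnf n) : nat :=
  #|[set a : {ffun 'I_n -> bool} | sat_cnf a F]|.

Definition is_2cnf n (G : cnf n) : bool := all (fun C => size C <= 2) G.

(* A formula together with its number of variables, some of which may not
   occur in any clause. *)
Record formula := Formula { nvars : nat; clauses : cnf nvars }.

Definition majority_sat (F : formula) : bool :=
  2 ^ (nvars F).-1 <= num_sat (clauses F).

Inductive symbol := Tick | Bar | Pos | Neg.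

Definition symbol_code (s : symbol) : bool * bool :=
  match s with
  | Tick => (false, false) | Bar => (false, true)
  | Pos => (true, false) | Neg => (true, true)
  end.
Definition symbol_decode (p : bool * bool) : symbol :=
  match p with
  | (false, false) => Tick | (false, true) => Bar
  | (true, false) => Pos | (true, true) => Neg
  end.
Lemma symbol_codeK : cancel symbol_code symbol_decode.
Proof. by case. Qed.
HB.instance Definition _ := Finite.copy symbol (can_type symbol_codeK).

(* With [Tick], [Bar], [Pos], [Neg] written 1, #, +, -, the formula
   (x_0 \/ ~ x_2) /\ x_1 on 3 variables is the word 111#+-11#+1.  The number n
   of variables is in unary, so that the word has length at least n; variable
   indices, being less than n, are in unary too, which changes the length only
   polynomially with respect to binary indices. *)
Definition encode_literal n (l : literal n) : seq symbol :=
  (if l.2 then Pos else Neg) :: nseq l.1 Tick.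
Definition encode_clause n (C : clause n) : seq symbol :=
  Bar :: flatten [seq encode_literal l | l <- C].
Definition encode_formula (F : formula) : seq symbol :=
  nseq (nvars F) Tick ++ flatten [seq encode_clause C | C <- clauses F].

Local Open Scope ring_scope.

Definition log2 (R : realType) (x : R) : R := ln x / ln 2.

(* The machine is given only the list of clauses of F = G /\ C_1 /\ ... /\ C_r,
   without a mark showing where G ends.  The bound on r is a promise rather than
   part of the question: for an uncomputable c the set of pairs (r, n) with
   r <= c log n is undecidable.  [0 < nvars F] makes log n meaningful; the base
   of the logarithm is immaterial, c being arbitrary. *)
Definition two_cnf_plus_log_clauses (R : realType) (c : R) (F : formula) :
    Prop :=
  (0 < nvars F)%N /\
  exists G Cs : cnf (nvars F),
    [/\ clauses F = G ++ Cs, is_2cnf G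
      & (size Cs)%:R <= c * log2 (nvars F)%:R].

(* Main.v *)
Require Import Defs.
From HB Require Import structures.
From mathcomp Require Import all_boot all_order all_algebra.
From mathcomp Require Import reals exp.
From mathcomp Require Import zify ring.
From mathcomp Require boolp.

Set Implicit Arguments.
Unset Strict Implicit.
Unset Printing Implicit Defensive.

Import Order.TTheory GRing.Theory Num.Theory.

(* Idea. Call a clause short if it has at most two literals and long otherwise;
   at most c log n clauses are long. Process the clauses one after the other
   along a binary decision tree, keeping a partial assignment rho. A clause C
   that is a tautology or satisfied by rho is skipped. If C is long, use
   #(rho, C /\ F) = #(rho, F) - #(rho /\ ~ C, F): two children, the second one
   with the opposite sign. If C is short, branch over the values of its at most
   two free variables, the branch that falsifies C being dead. Each leaf
   contributes (+-) 2^(number of free variables).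
   The short clauses that consume two variables along one branch are pairwise
   disjoint, so if there are three of them, F has at most (3/4)^3 2^n < 2^(n-1)
   models and can be rejected. Otherwise the tree has
   (number of clauses + 1) * 2^(4 + number of long clauses) leaves at most,
   which is polynomial in n.

   The machine enumerates the leaves with a tape of choice bits, recomputing
   each branch from the root, and adds up the contributions modulo 2^(n+1) on a
   binary counter of n+1 bits. *)

(** Counting the models of a 2-CNF is #P-hard, so an exact count is not attempted in general: the
    threshold 2^(n-1) is what allows giving up when many short clauses are disjoint. Three is the
    least number that works, since two of them leave a fraction 9/16 > 1/2. A long clause may have
    too many free variables to branch over; the subtraction fixes all of them at once for a factor
    2, so that c log n long clauses cost a factor n^c. A short clause with at most one free variable
    costs no factor: at most one child survives, and its dead leaf is paid for by the additive share
    of that clause in (number of clauses + 1). A short clause with two free variables costs at most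
    a factor 4, at most twice on a branch, whence 2^4. Partial sums of the signed contributions may
    be negative or too large. Modulo 2^(n+1) this is harmless, because the total lies between 0 and
    2^n. Recomputing each branch from the root makes the string of choices the whole state of the
    traversal, so the machine keeps no stack of partial assignments. *)

(** * Programs over four tapes, and their Turing machines *)

(* The cell of a variable on the second tape. [Pend b] marks a free variable
   that has to get the value [b] for the current clause to be false. *)
Inductive wsym := Free | Val of bool | Pend of bool.

Definition wsym_code (w : wsym) : option (bool * bool) :=
  match w with
  | Free => None | Val b => Some (false, b) | Pend b => Some (true, b)
  end.
Definition wsym_decode (p : option (bool * bool)) : wsym :=
  match p with
  | None => Free | Some (false, b) => Val b | Some (true, b) => Pend b
  end.
Lemma wsym_codeK : cancel wsym_code wsym_decode.
Proof. by case. Qed.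
HB.instance Definition _ := Finite.copy wsym (can_type wsym_codeK).

Notation cell := (option (symbol + wsym)).
Definition wcell (w : wsym) : cell := Some (inr w).
Definition scell (s : symbol) : cell := Some (inl s).

(* The registers: polarity of the current literal; number of its literals and
   of the pending cells, saturated; whether the clause is already satisfied;
   treatment of the pending cells (split, commit); whether the current branch
   is alive; its sign; number of short clauses split along it; whether three
   disjoint short clauses were found; whether the search is over. *)
Definition ctr : Type := bool * bool * bool.
Definition to_ctr (n : nat) : ctr := (0 < n, 1 < n, 2 < n).
Definition inc (x : ctr) : ctr := let: (a, b, _) := x in (true, a, b).

Record reg := Reg {
  sg : bool; len : ctr; pnd : ctr; sat : bool; spl : bool; com : bool;
  ok : bool; neg : bool; kk : ctr; rej : bool; dn : bool }.

Definition reg_code (r : reg) :=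
  (sg r, len r, pnd r, sat r, spl r, com r, ok r, neg r, kk r, rej r, dn r).
Definition reg_decode p :=
  let: (a, b, c, d, e, f, g, h, i, j, k) := p in Reg a b c d e f g h i j k.
Lemma reg_codeK : cancel reg_code reg_decode.
Proof. by case. Qed.
HB.instance Definition _ := Finite.copy reg (can_type reg_codeK).

(* Two-way tapes as pairs of streams, which identifies tapes that differ by
   trailing blanks only. *)
Record ztape := Zt { zleft : nat -> cell; zhead : cell; zright : nat -> cell }.

Definition zmove (d : move) (t : ztape) : ztape :=
  let: Zt l x r := t in
  match d with
  | MoveL => Zt (fun i => l i.+1) (l 0) (fun i => if i is j.+1 then r j else x)
  | MoveR => Zt (fun i => if i is j.+1 then l j else x) (r 0) (fun i => r i.+1)
  | Stay => t
  end.
Definition zact (a : cell * move) (t : ztape) : ztape :=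
  zmove a.2 (Zt (zleft t) a.1 (zright t)).

Definition ztape_of (t : tape (symbol + wsym)) : ztape :=
  Zt (nth None (left_of t)) (scanned t) (nth None (right_of t)).

Lemma zact_of x d t :
  ztape_of (move_head d (write_cell x t)) = zact (x, d) (ztape_of t).
Proof.
case: t => l y r; case: d => //=; rewrite /ztape_of /zact /=.
- congr Zt; apply: boolp.funext; last by case: l => [|? ?]; case.
  by case: l => [|? l] i //=; rewrite nth_nil.
- congr Zt; apply: boolp.funext; first by case.
  by case: r => [|? r] i //=; rewrite nth_nil.
Qed.

(* The head is on the first cell of [r]. *)
Definition tape_at (l r : seq cell) : ztape :=
  Zt (nth None l) (head None r) (nth None (behead r)).

Lemma tpE l r : tape_at l r = ztape_of (Tape l (head None r) (behead r)).
Proof. by []. Qed.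

Lemma zactR x l r : zact (x, MoveR) (tape_at l r) = tape_at (x :: l) (behead r).
Proof. by rewrite tpE -zact_of. Qed.

Lemma zactL x l r :
  zact (x, MoveL) (tape_at l r) = tape_at (behead l) (head None l :: x :: behead r).
Proof. by rewrite tpE -zact_of. Qed.

Lemma zactS x l r : zact (x, Stay) (tape_at l r) = tape_at l (x :: behead r).
Proof. by rewrite tpE -zact_of. Qed.

Lemma zact_keep t : zact (zhead t, Stay) t = t.
Proof. by case: t. Qed.

Lemma tape_at_head l r : tape_at l (head None r :: behead r) = tape_at l r.
Proof. by []. Qed.

Lemma tape_at_blankl l r : tape_at (rcons l None) r = tape_at l r.
Proof.
congr Zt; apply: boolp.funext => i; rewrite nth_rcons.
by case: ltngtP => // h; rewrite nth_default //; lia.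
Qed.

Lemma tape_at_nblankl n r : tape_at (nseq n None) r = tape_at [::] r.
Proof. by congr Zt; apply: boolp.funext => i; rewrite nth_nseq nth_nil if_same. Qed.

Record memory := Mem { rg : reg; ti : ztape; tr : ztape; tc : ztape; ta : ztape }.

Record out := Out {
  orr : reg; oi : cell * move; orh : cell * move; oc : cell * move;
  oa : cell * move }.

Definition view T (f : reg -> cell -> cell -> cell -> cell -> T) (m : memory) : T :=
  f (rg m) (zhead (ti m)) (zhead (tr m)) (zhead (tc m)) (zhead (ta m)).

Definition perform (o : out) (m : memory) : memory :=
  Mem (orr o) (zact (oi o) (ti m)) (zact (orh o) (tr m)) (zact (oc o) (tc m))
    (zact (oa o) (ta m)).

Notation action := (reg -> cell -> cell -> cell -> cell -> out).
Notation test := (reg -> cell -> cell -> cell -> cell -> bool).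

(* A program fragment: a transition to [None] leaves the fragment. *)
Record mach := Mach {
  mst : finType;
  mst0 : mst;
  mdl : mst -> reg -> cell -> cell -> cell -> cell -> option mst * out }.

Inductive runs (M : mach) : mst M -> memory -> nat -> memory -> Prop :=
| RunsExit s m o : view (mdl s) m = (None, o) -> runs s m 1 (perform o m)
| RunsStep s m s' o t m' : view (mdl s) m = (Some s', o) ->
    runs s' (perform o m) t m' -> runs s m t.+1 m'.

Definition exec (M : mach) (m : memory) (T : nat) (m' : memory) : Prop :=
  exists2 t, t <= T & runs (mst0 M) m t m'.

Lemma exec_le M m T U m' : T <= U -> exec M m T m' -> exec M m U m'.
Proof. by move=> TU [t tT ?]; exists t => //; apply: leq_trans TU. Qed.

Definition act (f : action) : mach :=
  @Mach unit tt (fun _ r a b c d => (None, f r a b c d)).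

Lemma exec_act f m m' : perform (view f m) m = m' -> exec (act f) m 1 m'.
Proof. by move=> <-; exists 1 => //; apply: RunsExit. Qed.

(** The exit transition of [M] enters the initial state of [N] in the same step, so running times
    simply add up. *)
Definition seqm (M N : mach) : mach :=
  @Mach (mst M + mst N)%type (inl (mst0 M)) (fun s r a b c d =>
    match s with
    | inl s => let: (s', o) := mdl s r a b c d in
               (Some (if s' is Some s' then inl s' else inr (mst0 N)), o)
    | inr s => let: (s', o) := mdl s r a b c d in (omap inr s', o)
    end).
Notation "M ;; N" := (seqm M N) (at level 60, right associativity).

Lemma exec_seq M N m T m1 U m2 :
  exec M m T m1 -> exec N m1 U m2 -> exec (M ;; N) m (T + U) m2.
Proof.
move=> [t tT r1] [u uU r2]; exists (t + u); first exact: leq_add.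
have {}r2 : @runs (M ;; N) (inr (mst0 N)) m1 u m2.
  elim: r2 => [s m' o e|s m' s' o v m'' e _ IH].
    by apply: RunsExit; move: e; rewrite /view /= => ->.
  by apply: RunsStep IH; move: e; rewrite /view /= => ->.
rewrite [mst0 _]/=.
elim: r1 r2 => [s m' o e|s m' s' o v m'' e _ IH] r2.
  by apply: RunsStep r2; move: e; rewrite /view /= => ->.
by rewrite addSn; apply: RunsStep (IH r2); move: e; rewrite /view /= => ->.
Qed.

Definition keep (c : cell) : cell * move := (c, Stay).

(** The test takes a step of its own, in state [None], which rewrites every scanned cell unchanged;
    this is the extra successor in [exec_whileS]. *)
Definition whilem (b : test) (M : mach) : mach :=
  @Mach (option (mst M)) None (fun s r w x y z =>
    match s with
    | None => (if b r w x y z then Some (Some (mst0 M)) else None,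
               Out r (keep w) (keep x) (keep y) (keep z))
    | Some s => let: (s', o) := mdl s r w x y z in (Some s', o)
    end).

Lemma perform_keep m : perform (view (fun r w x y z =>
  Out r (keep w) (keep x) (keep y) (keep z)) m) m = m.
Proof. by case: m => r i h c a; rewrite /perform /= !zact_keep. Qed.

Lemma exec_while0 (b : test) M m : ~~ view b m -> exec (whilem b M) m 1 m.
Proof.
move=> nb; exists 1 => //; rewrite -[X in runs _ _ _ X](perform_keep m).
by apply: RunsExit; rewrite /view /= ifN.
Qed.

Lemma exec_whileS (b : test) M m T m1 U m2 : view b m ->
  exec M m T m1 -> exec (whilem b M) m1 U m2 -> exec (whilem b M) m (T + U).+1 m2.
Proof.
move=> bm [t tT r1] [u uU r2]; exists (t + u).+1; first exact: leq_add.
apply: (@RunsStep (whilem b M) None m (Some (mst0 M))).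
  by rewrite /view /=; rewrite /view in bm; rewrite bm.
rewrite perform_keep.
elim: r1 r2 => [s m' o e|s m' s' o v m'' e _ IH] r2.
  by apply: RunsStep r2; move: e; rewrite /view /= => ->.
by rewrite addSn; apply: RunsStep (IH r2); move: e; rewrite /view /= => ->.
Qed.

(** * Translation of programs into four-tape Turing machines *)

Section Compile.
Variables (M : mach) (r0 : reg) (ans : reg -> bool).

Definition tm_state : finType := (option (mst M) * reg)%type.

Definition tm_delta (s : tm_state) (f : {ffun 'I_4 -> cell}) :
    tm_state * {ffun 'I_4 -> cell * move} :=
  let: (s', Out r a b c d) :=
    match s.1 with
    | Some q => mdl q s.2 (f (inord 0)) (f (inord 1)) (f (inord 2)) (f (inord 3))
    | None => (None, Out s.2 (keep None) (keep None) (keep None) (keep None))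
    end in
  ((s', r), [ffun i : 'I_4 => nth (keep None) [:: a; b; c; d] i]).

Definition compile : TM symbol :=
  @MkTM symbol 3 tm_state wsym (Some (mst0 M), r0)
    (fun s => if s.1 is None then Some (ans s.2) else None) tm_delta.

Definition mem_of (r : reg) (T : 'I_4 -> tape (symbol + wsym)) : memory :=
  Mem r (ztape_of (T (inord 0))) (ztape_of (T (inord 1)))
    (ztape_of (T (inord 2))) (ztape_of (T (inord 3))).

(** The tapes [T] of the machine are tracked only through their stream images, so any list
    representation of the same tapes will do along the run. *)
Lemma runs_compile q m t m' : @runs M q m t m' ->
  forall T : 'I_4 -> tape (symbol + wsym), mem_of (rg m) T = m ->
  cstate (iter t (@step _ compile) (@Config _ compile (Some q, rg m) T))
  = (None, rg m').
Proof.
have stepE q1 (m1 : memory) T s' o : mem_of (rg m1) T = m1 ->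
    view (mdl q1) m1 = (s', o) ->
  exists2 T', @step _ compile (@Config _ compile (Some q1, rg m1) T)
    = @Config _ compile (s', rg (perform o m1)) T' &
    mem_of (rg (perform o m1)) T' = perform o m1.
  move=> eT; rewrite -{1}eT /view /= /step /= /tm_delta /= !ffunE /= => ->.
  case: o => r a b c d /=; eexists; first reflexivity.
  rewrite /mem_of /perform /= !ffunE !inordK //=.
  by rewrite -eT /= !zact_of; case: a b c d => [? ?] [? ?] [? ?] [? ?].
elim=> [s m1 o e|s m1 s' o v m2 e _ IH] T eT.
  have [T' eS _] := stepE _ _ _ _ _ eT e.
  exact: (congr1 (fun c => cstate c) eS).
have [T' eS eT'] := stepE _ _ _ _ _ eT e.
rewrite iterSr.
exact: etrans (congr1 (fun c => cstate (iter v _ c)) eS) (IH _ eT').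
Qed.

(** A halting configuration is a fixed point of [step], so a run that ends early still shows its
    verdict at time [T]. *)
Lemma compile_answers w T m' :
  exec M (Mem r0 (tape_at [::] [seq scell s | s <- w])
    (tape_at [::] [::]) (tape_at [::] [::]) (tape_at [::] [::])) T m' ->
  answers_within compile w T (ans (rg m')).
Proof.
case=> t tT r; rewrite /answers_within -(subnK tT) iterD.
have e0 : mem_of r0 (ctapes (init compile w)) =
    Mem r0 (tape_at [::] [seq scell s | s <- w])
    (tape_at [::] [::]) (tape_at [::] [::]) (tape_at [::] [::]).
  rewrite /mem_of /=.
  have /negPf -> : inord 1 != ord0 :> 'I_4 by rewrite -val_eqE /= inordK.
  have /negPf -> : inord 2 != ord0 :> 'I_4 by rewrite -val_eqE /= inordK.
  have /negPf -> : inord 3 != ord0 :> 'I_4 by rewrite -val_eqE /= inordK.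
  by have -> : inord 0 == ord0 :> 'I_4 by rewrite -val_eqE /= inordK.
move: (runs_compile r e0).
set c := iter t _ _ => e; have {}e : cstate c = (None, rg m') by exact: e.
have fix_c : @step _ compile c = c by rewrite /step e.
by rewrite iter_fix ?e.
Qed.

End Compile.

(** * One clause *)

Arguments tape_at : simpl never.

Lemma zhead_tp l r : zhead (tape_at l r) = head None r.
Proof. by []. Qed.

Lemma zact_keepE t : zact (keep (zhead t)) t = t.
Proof. exact: zact_keep. Qed.

Lemma zact_keep_tp l r : zact (keep (head None r)) (tape_at l r) = tape_at l r.
Proof. exact: zact_keep. Qed.

Lemma zact_write_tp x l r : zact (keep x) (tape_at l r) = tape_at l (x :: behead r).
Proof. exact: zactS. Qed.

Lemma tape_at_blankr1 l x : tape_at l [:: x; None] = tape_at l [:: x].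
Proof. by congr Zt; apply: boolp.funext => -[|[]]. Qed.

Definition bcells (s : seq bool) : seq cell := [seq wcell (Val b) | b <- s].
Definition wcells (s : seq wsym) : seq cell := [seq wcell w | w <- s].

Inductive tid := TI | TR | TC | TA.

Definition mv (i : tid) (d : move) : action := fun r a b c e =>
  Out r (a, if i is TI then d else Stay) (b, if i is TR then d else Stay)
    (c, if i is TC then d else Stay) (e, if i is TA then d else Stay).

Definition nonblank (i : tid) : test := fun _ a b c e =>
  isSome (match i with TI => a | TR => b | TC => c | TA => e end).

(** The first move is unconditional because the head may rest on the blank after the last cell. The
    blank to the left of the first cell stops the loop, so every cell to the left of the head has to
    be nonblank. *)
Definition rewind (i : tid) : mach :=
  act (mv i MoveL) ;; whilem (nonblank i) (act (mv i MoveL)) ;; act (mv i MoveR).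

Definition get (i : tid) (m : memory) : ztape :=
  match i with TI => ti m | TR => tr m | TC => tc m | TA => ta m end.
Definition put (i : tid) (t : ztape) (m : memory) : memory :=
  let: Mem r x y z w := m in
  match i with
  | TI => Mem r t y z w | TR => Mem r x t z w | TC => Mem r x y t w
  | TA => Mem r x y z t
  end.

Lemma perform_mv i d m :
  perform (view (mv i d) m) m = put i (zact (zhead (get i m), d) (get i m)) m.
Proof. by case: m => r x y z w; case: i; rewrite /perform /= !zact_keep. Qed.

Lemma view_nonblank i m : view (nonblank i) m = isSome (zhead (get i m)).
Proof. by case: i. Qed.

Lemma get_put i t m : get i (put i t m) = t.
Proof. by case: m; case: i. Qed.

Lemma put_put i t u m : put i t (put i u m) = put i t m.
Proof. by case: m; case: i. Qed.

Lemma rewind_ex i l r m : get i m = tape_at l r -> all isSome l ->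
  exec (rewind i) m (2 * size l + 3) (put i (tape_at [::] (catrev l r)) m).
Proof.
move=> em al; have -> : 2 * size l + 3 = 1 + ((2 * size l).+1 + 1) by lia.
apply: exec_seq; first by apply: exec_act; rewrite perform_mv em zhead_tp zactL.
apply: (exec_seq (m1 := put i (tape_at [::] (None :: catrev l r)) m)); last first.
  apply: exec_act; rewrite perform_mv get_put put_put zactR zhead_tp /=.
  by rewrite (tape_at_blankl [::]).
have -> : tape_at (behead l) [:: head None l, head None r & behead r] =
    tape_at (behead l) (head None l :: r) by case: (r) => //; apply: tape_at_blankr1.
elim: l r al {em} => [|x l IH] r /= => [_|/andP[xS al]].
  by apply: exec_while0; rewrite view_nonblank get_put.
have -> : (2 * (size l).+1).+1 = (1 + (2 * size l).+1).+1 by lia.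
apply: exec_whileS; first by rewrite view_nonblank get_put.
  by apply: exec_act; rewrite perform_mv get_put put_put zactL.
exact: IH.
Qed.

Lemma rewind_to i T l r s m m' : get i m = tape_at l r -> all isSome l ->
  catrev l r = s -> put i (tape_at [::] s) m = m' -> 2 * size l + 3 <= T ->
  exec (rewind i) m T m'.
Proof. by move=> em al <- <- le; apply: exec_le le (rewind_ex em al). Qed.

Lemma all_wcells s : all isSome (wcells s).
Proof. by rewrite all_map; apply/allP. Qed.

Lemma all_catrev T (a : pred T) (s t : seq T) :
  all a (catrev s t) = all a s && all a t.
Proof. by rewrite catrevE all_cat all_rev. Qed.

(** The flag means that the clause needs no further treatment: over [Val] the literal is already
    true; over [Pend] the clause contains two complementary literals and is a tautology. *)
Definition litw (b : bool) (w : wsym) : wsym * bool :=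
  match w with Free => (Pend (~~ b), false) | Val c | Pend c => (w, c == b) end.

Definition is_free (w : wsym) : bool := if w is Free then true else false.
Definition is_pend (w : wsym) : bool := if w is Pend _ then true else false.

Definition lit_read : action := fun r a b c d =>
  let: Reg _ len pnd sat sp cm ok ng k rj dn := r in
  Out (Reg (a == scell Pos) (inc len) pnd sat sp cm ok ng k rj dn)
    (a, MoveR) (keep b) (keep c) (keep d).

Definition lit_update : action := fun r a b c d =>
  let: Reg sg len pnd sat sp cm ok ng k rj dn := r in
  if b is Some (inr w) then
    Out (Reg sg len (if is_free w then inc pnd else pnd) (sat || (litw sg w).2)
           sp cm ok ng k rj dn)
      (keep a) (keep (wcell (litw sg w).1)) (keep c) (keep d)
  else Out r (keep a) (keep b) (keep c) (keep d).

Definition literal_prog : mach :=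
  act lit_read ;;
  whilem (fun _ a _ _ _ => a == scell Tick)
    (act (fun r a b c d => Out r (a, MoveR) (b, MoveR) (keep c) (keep d))) ;;
  act lit_update ;;
  rewind TR.

(** A missing choice bit reads as false and is written back, so the choice tape ends up holding the
    whole path. When a short clause is split, [ok] is cleared: from there on it records whether some
    literal has become true, and [scan] sets it again. *)
Definition decide : action := fun r a b c d =>
  let: Reg sg len pnd sat sp cm ok ng k rj dn := r in
  let x := c == wcell (Val true) in
  if sat then
    Out (Reg sg len pnd sat false false ok ng k rj dn)
      (keep a) (keep b) (keep c) (keep d)
  else if len.2 then
    Out (Reg sg len pnd sat false x ok (ng (+) x) k rj dn)
      (keep a) (keep b) (wcell (Val x), MoveR) (keep d)
  else if pnd.1.2 && k.1.2 then
    Out (Reg sg len pnd sat false false false ng k true dn)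
      (keep a) (keep b) (keep c) (keep d)
  else
    Out (Reg sg len pnd sat true false false ng (if pnd.1.2 then inc k else k)
           rj dn)
      (keep a) (keep b) (keep c) (keep d).

(** In a split, the bit true selects the value that falsifies the literal. The branch thus dies
    exactly when all bits spent on the clause are true. *)
Definition scan : action := fun r a b c d =>
  let: Reg sg len pnd sat sp cm ok ng k rj dn := r in
  let x := c == wcell (Val true) in
  if b is Some (inr (Pend v)) then
    if sp then
      Out (Reg sg len pnd sat sp cm (ok || ~~ x) ng k rj dn)
        (keep a) (wcell (Val (x == v)), MoveR) (wcell (Val x), MoveR) (keep d)
    else
      Out r (keep a) (wcell (if cm then Val v else Free), MoveR) (keep c) (keep d)
  else Out r (keep a) (b, MoveR) (keep c) (keep d).

Definition reset : action := fun r a b c d =>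
  let: Reg _ _ _ _ _ _ ok ng k rj dn := r in
  Out (Reg false (to_ctr 0) (to_ctr 0) false false false ok ng k rj dn)
    (keep a) (keep b) (keep c) (keep d).

Definition clause_prog : mach :=
  act (mv TI MoveR) ;;
  whilem (fun _ a _ _ _ => (a == scell Pos) || (a == scell Neg)) literal_prog ;;
  act decide ;;
  whilem (nonblank TR) (act scan) ;;
  act reset ;;
  rewind TR.

Definition pass_prog : mach :=
  whilem (fun r a _ _ _ => (a == scell Bar) && ok r) clause_prog.

Lemma exec_actseq f N m U m2 :
  exec N (perform (view f m) m) U m2 -> exec (act f ;; N) m U.+1 m2.
Proof. by rewrite -add1n; apply: exec_seq; apply: exec_act. Qed.

Lemma exec_while_act (b : test) f m U m2 : view b m ->
  exec (whilem b (act f)) (perform (view f m) m) U m2 ->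
  exec (whilem b (act f)) m U.+2 m2.
Proof. by move=> bm; rewrite -[U.+1]add1n; apply: exec_whileS => //; apply: exec_act. Qed.

(* Symbolic execution on tapes of the form [tape_at l r]. *)
Ltac sym_exec := rewrite /view /perform /= ?zhead_tp /=
  ?zact_keepE ?zact_keep_tp
  ?zactR ?zactL ?zact_write_tp /= ?tape_at_head.

Definition lit_cells n (l : literal n) : seq cell :=
  [seq scell s | s <- encode_literal l].

Lemma literal_ex n (l : literal n) s0 L P st o ng k rj li ri p tcc taa :
  size p = n -> head None ri != scell Tick ->
  exec literal_prog
    (Mem (Reg s0 (to_ctr L) (to_ctr P) st false false o ng k rj false)
       (tape_at li (lit_cells l ++ ri)) (tape_at [::] (wcells p)) tcc taa)
    (6 * n.+1)
    (Mem (Reg l.2 (to_ctr L.+1) (to_ctr (P + is_free (nth Free p l.1)))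
            (st || (litw l.2 (nth Free p l.1)).2) false false o ng k rj false)
       (tape_at (catrev (lit_cells l) li) ri)
       (tape_at [::] (wcells (set_nth Free p l.1 (litw l.2 (nth Free p l.1)).1)))
       tcc taa).
Proof.
case: l => -[i /= ltin] b sp hd; set w := nth _ _ _.
apply: (@exec_le _ _ ((2 * i).+1 + (2 * i + 3).+1).+1); first by lia.
rewrite /lit_cells /encode_literal /= map_nseq.
apply: exec_actseq; sym_exec.
have -> : (scell (if b then Pos else Neg) == scell Pos) = b by case: b.
set x := scell (if b then _ else _).
have ep : p = take i p ++ w :: drop i.+1 p.
  by rewrite -drop_nth ?cat_take_drop ?sp.
apply: (exec_seq (m1 := Mem (Reg b (to_ctr L.+1) (to_ctr P) st false false o ng k
    rj false) (tape_at (catrev (nseq i (scell Tick)) (x :: li)) ri)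
    (tape_at (catrev (wcells (take i p)) [::]) (wcells (drop i p))) tcc taa)).
  have : wcells p = wcells (take i p) ++ wcells (drop i p).
    by rewrite -map_cat cat_take_drop.
  move=> ->; have : size (wcells (take i p)) = i.
    by rewrite size_map size_take sp ltin.
  move: (wcells _) (wcells _) [::] (x :: li) => u v u' l'.
  elim: i v u' l' {ltin w ep} => [|i IH] [|y v] // u' l' => [_|[ev]] /=.
    by apply: exec_while0; sym_exec.
  have -> : (2 * i.+1).+1 = (2 * i).+3 by lia.
  by apply: exec_while_act; sym_exec => //; exact: IH.
apply: exec_actseq; rewrite (drop_nth Free) ?sp // -/w; sym_exec.
rewrite (_ : (if _ then _ else _) = to_ctr (P + is_free w)); last first.
  by case: ifP => _; rewrite ?addn1 ?addn0.
apply: (rewind_to (l := catrev (wcells (take i p)) [::])) => //.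
- by rewrite all_catrev all_wcells.
- rewrite set_nthE sp ltin /wcells map_cat /= -/(wcells _) -/(wcells _).
  by rewrite !catrevE cats0 revK.
- by rewrite catrevE cats0 size_rev size_map size_take sp ltin.
Qed.

Fixpoint lits n (C : clause n) (p : seq wsym) (st : bool) : seq wsym * bool :=
  if C is l :: C' then
    let (w, t) := litw l.2 (nth Free p l.1) in
    lits C' (set_nth Free p l.1 w) (st || t)
  else (p, st).

Lemma size_set_var n (i : 'I_n) p w : size p = n ->
  size (set_nth Free p i w) = n.
Proof. by move=> sp; rewrite size_set_nth sp; apply/maxn_idPr. Qed.

Lemma size_lits n (C : clause n) p st : size p = n -> size (lits C p st).1 = n.
Proof.
elim: C p st => //= l C IH p st sp; case: (litw _ _) => w t.
by rewrite IH // size_set_var.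
Qed.

Lemma count_pend_litw n (l : literal n) p : size p = n ->
  count is_pend (set_nth Free p l.1 (litw l.2 (nth Free p l.1)).1)
  = count is_pend p + is_free (nth Free p l.1).
Proof.
move=> sp; have lt : l.1 < size p by rewrite sp.
rewrite -{3}(cat_take_drop l.1 p) (drop_nth Free lt) set_nthE lt !count_cat /=.
by case: (nth _ _ _) => //= *; lia.
Qed.

Definition clause_cells n (C : clause n) : seq cell :=
  flatten [seq lit_cells l | l <- C].

Lemma lits_ex n (C : clause n) s0 L p st o ng k rj li ri tcc taa :
  size p = n -> head None ri \in [:: None; scell Bar] ->
  exists s1, exec
    (whilem (fun _ a _ _ _ => (a == scell Pos) || (a == scell Neg)) literal_prog)
    (Mem (Reg s0 (to_ctr L) (to_ctr (count is_pend p)) st false false o ng k rj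
            false)
       (tape_at li (clause_cells C ++ ri)) (tape_at [::] (wcells p)) tcc taa)
    (7 * n.+1 * size C).+1
    (Mem (Reg s1 (to_ctr (L + size C)) (to_ctr (count is_pend (lits C p st).1))
            (lits C p st).2 false false o ng k rj false)
       (tape_at (catrev (clause_cells C) li) ri)
       (tape_at [::] (wcells (lits C p st).1)) tcc taa).
Proof.
move=> + hd; elim: C s0 L p st li => [|l C IH] s0 L p st li sp.
  exists s0; rewrite muln0 addn0; apply: exec_while0.
  by rewrite /view zhead_tp /=; move: hd; rewrite !inE => /orP[]/eqP->.
have [s1 {}IH] := IH l.2 L.+1 _ (st || (litw l.2 (nth Free p l.1)).2)
  (catrev (lit_cells l) li) (size_set_var l.1 (litw l.2 (nth Free p l.1)).1 sp).
exists s1; apply: (@exec_le _ _ (6 * n.+1 + (7 * n.+1 * size C).+1).+1).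
  by rewrite /=; nia.
have -> : clause_cells (l :: C) = lit_cells l ++ clause_cells C by [].
rewrite -catA; apply: exec_whileS.
- by rewrite /view zhead_tp /= /encode_literal; case: (l.2).
- apply: literal_ex => //; case: (C) => [|l' C'] /=.
    by move: hd; rewrite !inE => /orP[]/eqP->.
  by rewrite /encode_literal; case: (l'.2).
- rewrite catrev_catl addnS -addSn /=; move: IH; rewrite count_pend_litw //.
  by case: (litw _ _).
Qed.

(** * Decision trees as a specification of the program *)

Inductive leaf := Dead | Refuted | Alive of bool & seq wsym.
Inductive tree := Leaf of leaf | Br of tree & tree.

Definition extend (s : seq bool) (x : leaf * seq bool) : leaf * seq bool :=
  (x.1, s ++ x.2).

(** Choices beyond the end of [s] default to false, as blanks do on the choice tape. The second
    component is the complete path to the leaf, which may be longer or shorter than [s]. *)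
Fixpoint follow (t : tree) (s : seq bool) : leaf * seq bool :=
  match t with
  | Leaf lf => (lf, [::])
  | Br t0 t1 =>
    let b := head false s in
    extend [:: b] (follow (if b then t1 else t0) (behead s))
  end.

(** Written with a continuation [K] for the remaining clauses, in the order in which the machine
    scans its cells. [d] is the scanned part, reversed; [o] tells whether a literal is already true,
    like the register [ok]. *)
Fixpoint split_tree (d p : seq wsym) (o : bool) (K : seq wsym -> bool -> tree)
    : tree :=
  match p with
  | [::] => K (rev d) o
  | Pend v :: p' => Br (split_tree (Val (~~ v) :: d) p' true K)
                       (split_tree (Val v :: d) p' o K)
  | w :: p' => split_tree (w :: d) p' o K
  end.

Definition settle (b : bool) (w : wsym) : wsym :=
  if w is Pend v then (if b then Val v else Free) else w.

Definition node n (C : clause n) p ng k (K : seq wsym -> bool -> nat -> tree)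
    : tree :=
  let (q, st) := lits C p false in
  if st then K (map (settle false) q) ng k
  else if 2 < size C then
    Br (K (map (settle false) q) ng k) (K (map (settle true) q) (~~ ng) k)
  else
    let two := 1 < count is_pend q in
    if two && (1 < k) then Leaf Refuted
    else split_tree [::] q false
           (fun q' o => if o then K q' ng (k + two) else Leaf Dead).

Fixpoint dtree n (F : cnf n) p ng k : tree :=
  if F is C :: F' then node C p ng k (dtree F') else Leaf (Alive ng p).

Lemma head_bcells s : (head None (bcells s) == wcell (Val true)) = head false s.
Proof. by case: s => [|[] s]. Qed.

Lemma behead_bcells s : behead (bcells s) = bcells (behead s).
Proof. by case: s. Qed.

Lemma settle_ex q u b o ng k rj s1 L P st ti0 tc0 ta0 :
  exec (whilem (nonblank TR) (act scan))
    (Mem (Reg s1 L P st false b o ng k rj false) ti0 (tape_at u (wcells q)) tc0 ta0)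
    (2 * size q).+1
    (Mem (Reg s1 L P st false b o ng k rj false) ti0
       (tape_at (catrev (wcells (map (settle b) q)) u) [::]) tc0 ta0).
Proof.
elim: q u => [|w q IH] u /=; first by apply: exec_while0.
rewrite (_ : (2 * _).+1 = (2 * size q).+3); last by lia.
by apply: exec_while_act => //; case: w => [|v|v]; sym_exec; apply: IH.
Qed.

Lemma split_ex q d o s lc K ng k rj s1 L P st ti0 ta0 :
  exists q' o' y,
  [/\ count is_pend q' = count is_pend d, follow (split_tree d q o K) s
        = extend y (follow (K q' o') (drop (size y) s)),
      size q' = size d + size q &
  exec (whilem (nonblank TR) (act scan))
    (Mem (Reg s1 L P st true false o ng k rj false) ti0
       (tape_at (wcells d) (wcells q)) (tape_at lc (bcells s)) ta0)
    (2 * size q).+1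
    (Mem (Reg s1 L P st true false o' ng k rj false) ti0
       (tape_at (catrev (wcells q') [::]) [::])
       (tape_at (catrev (bcells y) lc) (bcells (drop (size y) s))) ta0)].
Proof.
elim: q d o s lc => [|w q IH] d o s lc /=.
  exists (rev d), o, [::]; rewrite drop0 size_rev addn0 count_rev.
  split=> //; first by case: follow.
  by rewrite catrevE cats0 -map_rev revK; apply: exec_while0.
have e2 : (2 * (size q).+1).+1 = (2 * size q).+3 by lia.
case: w => [|v|v] /=.
- have [q' [o' [y [c e eq' E]]]] := IH (Free :: d) o s lc.
  exists q', o', y; split=> //; first by rewrite eq' addSnnS.
  by rewrite e2; apply: exec_while_act => //; sym_exec.
- have [q' [o' [y [c e eq' E]]]] := IH (Val v :: d) o s lc.
  exists q', o', y; split=> //; first by rewrite eq' addSnnS.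
  by rewrite e2; apply: exec_while_act => //; sym_exec.
- have [q' [o' [y [c e eq' E]]]] := IH (Val (head false s == v) :: d)
    (o || ~~ head false s) (behead s) (wcell (Val (head false s)) :: lc).
  have eD : drop (size y) (behead s) = drop (size y).+1 s.
    by rewrite -drop1 drop_drop addn1.
  rewrite eD in e E.
  exists q', o', (head false s :: y); split=> //; last 1 first.
  + rewrite e2; apply: exec_while_act => //; sym_exec.
    by rewrite head_bcells behead_bcells.
  + move: e; rewrite [size (_ :: _)]/=.
    by case: (head false s); rewrite ?orbT ?orbF => e; rewrite /extend /=;
      case: (v) e => /= ->.
  + by rewrite eq' addSnnS.
Qed.

Definition code n (F : cnf n) : seq cell :=
  flatten [seq scell Bar :: clause_cells C | C <- F].

Notation regs o ng k rj d :=
  (Reg false (to_ctr 0) (to_ctr 0) false false false o ng (to_ctr k) rj d).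

Lemma clause_end_ex p n s1 L P st sp cm o ng k rj ti0 tc0 ta0 : size p = n ->
  exec (act reset ;; rewind TR)
    (Mem (Reg s1 L P st sp cm o ng k rj false) ti0
       (tape_at (catrev (wcells p) [::]) [::]) tc0 ta0)
    (2 * n + 4)
    (Mem (Reg false (to_ctr 0) (to_ctr 0) false false false o ng k rj false) ti0
       (tape_at [::] (wcells p)) tc0 ta0).
Proof.
move=> sp'; rewrite addnS; apply: exec_actseq; sym_exec.
apply: (rewind_to (l := catrev (wcells p) [::]) (r := [::])) => //.
- by rewrite all_catrev all_wcells.
- by rewrite !catrevE !cats0 revK.
- by rewrite catrevE cats0 size_rev size_map sp'.
Qed.

Lemma settle_end_ex n q b o ng k rj s1 L P st ti0 tc0 ta0 : size q = n ->
  exec (whilem (nonblank TR) (act scan) ;; act reset ;; rewind TR)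
    (Mem (Reg s1 L P st false b o ng k rj false) ti0 (tape_at [::] (wcells q)) tc0 ta0)
    ((2 * n).+1 + (2 * n + 4))
    (Mem (Reg false (to_ctr 0) (to_ctr 0) false false false o ng k rj false) ti0
       (tape_at [::] (wcells (map (settle b) q))) tc0 ta0).
Proof.
move=> <-; apply: exec_seq (settle_ex _ _ _ _ _ _ _ _ _ _ _ _ _ _) _.
by apply: clause_end_ex; rewrite size_map.
Qed.

Lemma count_settle b p : count is_pend (map (settle b) p) = 0.
Proof. by elim: p => //= -[|v|v] p //=; case: b. Qed.

Lemma clause_ex n (C : clause n) p ng k s lc li ri K ta0 :
  size p = n -> count is_pend p = 0 ->
  head None ri \in [:: None; scell Bar] ->
  exists y q ng' k' (o rj : bool),
  [/\ size q = n, o -> count is_pend q = 0 /\ rj = false,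
    follow (node C p ng k K) s =
      extend y (if o then follow (K q ng' k') (drop (size y) s)
                else (if rj then Refuted else Dead, [::])) &
    exec clause_prog
      (Mem (regs true ng k false false)
         (tape_at li ((scell Bar :: clause_cells C) ++ ri))
         (tape_at [::] (wcells p)) (tape_at lc (bcells s)) ta0)
      (8 * n.+1 * (size C).+1)
      (Mem (regs o ng' k' rj false)
         (tape_at (catrev (scell Bar :: clause_cells C) li) ri)
         (tape_at [::] (wcells q))
         (tape_at (catrev (bcells y) lc) (bcells (drop (size y) s))) ta0)].
Proof.
move=> sp cp hd.
pose Tm := (7 * n.+1 * size C).+1 + ((2 * n).+1 + (2 * n + 4)).+1.
have Tle : Tm.+1 <= 8 * n.+1 * (size C).+1 by rewrite /Tm; nia.
have [s1] := lits_ex C false 0 false true ng (to_ctr k) false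
  (scell Bar :: li) (tape_at lc (bcells s)) ta0 sp hd.
rewrite cp add0n /node; have := size_lits C false sp.
case: (lits C p false) => q st /= sq E.
have fin m2 : exec (act decide ;; whilem (nonblank TR) (act scan) ;;
      act reset ;; rewind TR)
    (Mem (Reg s1 (to_ctr (size C)) (to_ctr (count is_pend q)) st false false
            true ng (to_ctr k) false false)
       (tape_at (catrev (clause_cells C) (scell Bar :: li)) ri)
       (tape_at [::] (wcells q)) (tape_at lc (bcells s)) ta0)
    ((2 * n).+1 + (2 * n + 4)).+1 m2 ->
  exec clause_prog
    (Mem (regs true ng k false false)
       (tape_at li ((scell Bar :: clause_cells C) ++ ri))
       (tape_at [::] (wcells p)) (tape_at lc (bcells s)) ta0)
    (8 * n.+1 * (size C).+1) m2.
  move=> E2; apply: exec_le Tle _; apply: exec_actseq; sym_exec.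
  by rewrite /Tm; apply: exec_seq E E2.
have sm b : size (map (settle b) q) = n by rewrite size_map.
case: st E fin => E fin.
  exists [::], (map (settle false) q), ng, k, true, false.
  split=> //; first by rewrite count_settle.
    by rewrite drop0; case: follow.
  apply: fin; apply: exec_actseq; sym_exec; rewrite drop0.
  exact: settle_end_ex.
case: ifP => long.
  pose x := head false s.
  exists [:: x], (map (settle x) q), (ng (+) x), k, true, false.
  split=> //; first by rewrite count_settle.
    by rewrite /= drop1 -/x; case: x; rewrite ?addbT ?addbF.
  apply: fin; apply: exec_actseq; sym_exec; rewrite long drop1; sym_exec.
  rewrite head_bcells behead_bcells -/x.
  exact: settle_end_ex.
case: ifP => two.
  exists [::], (map (settle false) q), ng, k, false, true; split=> //.
  apply: fin; apply: exec_actseq; sym_exec; rewrite long two; sym_exec; rewrite drop0.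
  exact: settle_end_ex.
pose K' q' (o : bool) :=
  if o then K q' ng (k + (1 < count is_pend q)) else Leaf Dead.
have [q' [o' [y [c e eq' E']]]] := split_ex q [::] false s lc K' ng
  (to_ctr (k + (1 < count is_pend q))) false s1 (to_ctr (size C))
  (to_ctr (count is_pend q)) false
  (tape_at (catrev (clause_cells C) (scell Bar :: li)) ri) ta0.
rewrite sq in eq' E'.
exists y, q', ng, (k + (1 < count is_pend q)), o', false; split=> //.
  by rewrite e /K'; case: (o').
apply: fin; apply: exec_actseq; sym_exec; rewrite long two; sym_exec.
rewrite (_ : (if _ then _ else _) = to_ctr (k + (1 < count is_pend q))); last first.
  by case: ifP => _; rewrite ?addn1 ?addn0.
by apply: exec_seq E' _; apply: clause_end_ex.
Qed.

(** * One branch of the decision tree *)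

Definition width n (F : cnf n) : nat := sumn [seq (size C).+1 | C <- F].
Definition is_alive (lf : leaf) : bool := if lf is Alive _ _ then true else false.
Definition is_refuted (lf : leaf) : bool :=
  if lf is Refuted then true else false.

(** A branch that dies leaves the head in the middle of the input. Hence only [catrev l r] is
    determined, together with the absence of blanks in [l], which is what rewinding requires. *)
Lemma pass_ex n (F : cnf n) p ng k s lc li ta0 :
  size p = n -> count is_pend p = 0 ->
  exists y lf l r q ng' k',
  [/\ follow (dtree F p ng k) s = (lf, y),
    catrev l r = catrev li (code F) /\ (all isSome li -> all isSome l),
    size q = n,
    (if lf is Alive b q' then b = ng' /\ q' = q else True) &
    exec pass_prog
      (Mem (regs true ng k false false) (tape_at li (code F)) (tape_at [::] (wcells p))
         (tape_at lc (bcells s)) ta0)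
      (9 * n.+1 * width F).+1
      (Mem (regs (is_alive lf) ng' k' (is_refuted lf) false) (tape_at l r)
         (tape_at [::] (wcells q))
         (tape_at (catrev (bcells y) lc) (bcells (drop (size y) s))) ta0)].
Proof.
elim: F p ng k s lc li => [|C F IH] p ng k s lc li sp cp.
  exists [::], (Alive ng p), li, [::], p, ng, k; split=> //.
  by rewrite drop0 muln0; apply: exec_while0.
have hd : head None (code F) \in [:: None; scell Bar] by case: (F).
have [y [q [ng' [k' [o [rj [sq oP e E]]]]]]] :=
  clause_ex C ng k s lc li (dtree F) ta0 sp cp hd.
have ale : all isSome (scell Bar :: clause_cells C).
  by apply/allP => x /= /predU1P[->//|/flattenP[u /mapP[l _ ->]] /mapP[? _ ->]].
have Tle U : U <= (9 * n.+1 * width F).+1 ->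
    (8 * n.+1 * (size C).+1 + U).+1 <= (9 * n.+1 * width (C :: F)).+1.
  by rewrite /width /=; nia.
have w0 : view (fun r a _ _ _ => (a == scell Bar) && ok r)
    (Mem (regs true ng k false false) (tape_at li (code (C :: F))) (tape_at [::] (wcells p))
       (tape_at lc (bcells s)) ta0) by [].
case: o oP e E => [/(_ isT)[cq ->]|_] e E.
  have [y' [lf [l [r [q' [ng2 [k2 [e' [el al] sq' eA E']]]]]]]] :=
    IH q ng' k' (drop (size y) s) (catrev (bcells y) lc)
      (catrev (scell Bar :: clause_cells C) li) sq cq.
  exists (y ++ y'), lf, l, r, q', ng2, k2; split=> //.
  - by rewrite [follow _ _]e e'.
  - split=> [|ai]; first by rewrite el !catrevE rev_cat revK -catA.
    by apply: al; rewrite all_catrev ale.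
  - apply: exec_le (Tle _ (leqnn _)) _; apply: exec_whileS w0 E _.
    by move: E'; rewrite drop_drop size_cat addnC /bcells map_cat catrev_catl.
exists y, (if rj then Refuted else Dead), (catrev (scell Bar :: clause_cells C) li).
exists (code F), q, ng', k'; split=> //.
- by rewrite [follow _ _]e /extend cats0.
- split=> [|ai]; first by rewrite !catrevE rev_cat revK -catA.
  by rewrite all_catrev ale.
- by case: (rj).
- apply: exec_le (Tle 1 _) _; first by lia.
  apply: exec_whileS w0 E _; case: (rj) => /=; apply: exec_while0;
    by rewrite /view /= andbF.
Qed.

Definition set_ok : action := fun r a b c d =>
  let: Reg sg len pnd sat sp cm _ ng k rj dn := r in
  Out (Reg sg len pnd sat sp cm true ng k rj dn)
    (keep a) (keep b) (keep c) (keep d).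

(* Moves the head of the accumulator to the bit of weight 2^(number of free
   variables), and frees all variables. *)
Definition free_all : action := fun r a b c d =>
  Out r (keep a) (wcell Free, MoveR) (keep c)
    (d, if b == wcell Free then MoveR else Stay).

Definition carry_test : test := fun r _ _ _ d =>
  ok r && (d == wcell (Val (~~ neg r))).
Definition carry : action := fun r a b c d =>
  Out r (keep a) (keep b) (keep c) (wcell (Val (neg r)), MoveR).
Definition carry_stop : action := fun r a b c d =>
  Out r (keep a) (keep b) (keep c)
    (keep (if ok r && isSome d then wcell (Val (~~ neg r)) else d)).

Definition advance : action := fun r a b c d =>
  let: Reg sg len pnd sat sp cm _ _ _ rj _ := r in
  Out (Reg sg len pnd sat sp cm false false (to_ctr 0) rj (rj || ~~ isSome c))
    (keep a) (keep b) (keep (if isSome c then wcell (Val true) else None))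
    (keep d).

Definition branch_prog : mach :=
  act set_ok ;; pass_prog ;; rewind TI ;;
  whilem (nonblank TR) (act free_all) ;; rewind TR ;;
  (whilem carry_test (act carry) ;; act carry_stop) ;; rewind TA ;;
  (act (mv TC MoveL) ;;
   whilem (fun _ _ _ c _ => c == wcell (Val true))
     (act (fun r a b c d => Out r (keep a) (keep b) (None, MoveL) (keep d)))) ;;
  act advance ;; rewind TC.

(** On reversed strings: trailing trues are dropped and the last false becomes true. With missing
    choices read as false, [next y] leads to the leaf that follows the end of [y] in depth-first
    order, and it is empty exactly after the last leaf. *)
Fixpoint strip (l : seq bool) : seq bool :=
  match l with true :: l' => strip l' | false :: l' => true :: l' | [::] => [::] end.
Definition next (y : seq bool) : seq bool := rev (strip (rev y)).

(* Adds or subtracts 1 modulo 2^(size A), least significant bit first. *)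
Fixpoint ripple (ng : bool) (A : seq bool) : seq bool :=
  if A is b :: A' then
    if b == ~~ ng then ng :: ripple ng A' else ~~ ng :: A'
  else [::].

Definition add_leaf (lf : leaf) (A : seq bool) : seq bool :=
  if lf is Alive ng q then
    let c := count is_free q in take c A ++ ripple ng (drop c A)
  else A.

Lemma size_ripple ng A : size (ripple ng A) = size A.
Proof. by elim: A => //= b A IH; case: ifP => //= _; rewrite IH. Qed.

Lemma size_add_leaf lf A : size (add_leaf lf A) = size A.
Proof. by case: lf => //= ng q; rewrite size_cat size_ripple -size_cat cat_take_drop. Qed.

Lemma free_all_ex q u v w r0 ti0 tc0 : count is_free q <= size w ->
  exec (whilem (nonblank TR) (act free_all))
    (Mem r0 ti0 (tape_at u (wcells q)) tc0 (tape_at v w))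
    (2 * size q).+1
    (Mem r0 ti0 (tape_at (catrev (wcells (nseq (size q) Free)) u) [::]) tc0
       (tape_at (catrev (take (count is_free q) w) v) (drop (count is_free q) w))).
Proof.
elim: q u v w => [|x q IH] u v w /=.
  by move=> _; rewrite take0 drop0; apply: exec_while0.
rewrite (_ : (2 * _).+1 = (2 * size q).+3); last by lia.
move=> cw; apply: exec_while_act => //; case: x cw => [|b|b]; sym_exec.
- by case: w => // y w cw; apply: IH; exact: cw.
- by move=> cw; apply: IH.
- by move=> cw; apply: IH.
Qed.

(** The effect of [carry_stop] where the carry is absorbed. Past the most significant bit nothing is
    written, so the carry is lost: this is the reduction modulo [2 ^ size A]. *)
Definition stop_at (ng : bool) (A : seq bool) : seq bool :=
  if A is _ :: A' then ~~ ng :: A' else [::].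

Lemma carry_ex ng A v k rj ti0 tr0 tc0 : all isSome v ->
  exists v' A',
  [/\ catrev v' (bcells (stop_at ng A')) = catrev v (bcells (ripple ng A)),
    all isSome v', size v' <= size v + size A &
  exec (whilem carry_test (act carry))
    (Mem (regs true ng k rj false) ti0 tr0 tc0 (tape_at v (bcells A)))
    (2 * size A).+1
    (Mem (regs true ng k rj false) ti0 tr0 tc0 (tape_at v' (bcells A')))].
Proof.
elim: A v => [|b A IH] v av /=.
  by exists v, [::]; split=> //; [rewrite addn0 | apply: exec_while0].
rewrite (_ : (2 * _).+1 = (2 * size A).+3); last by lia.
case: ifP => eb.
  have [v' [A' [e al sv E]]] := IH (wcell (Val ng) :: v) av.
  exists v', A'; split=> //; first by rewrite addnS -addSn.
  apply: exec_while_act; last by sym_exec.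
  by rewrite /view /carry_test /= (eqP eb) eqxx.
exists v, (b :: A); split=> //; first by rewrite leq_addr.
apply: (@exec_le _ _ 1) => //; apply: exec_while0.
by rewrite /view /carry_test /=; move: eb; case: b; case: (ng).
Qed.

Lemma strip_ex l r0 ti0 tr0 ta0 :
  exists b l',
  [/\ strip l = (if b then true :: l' else [::]), size l' <= size l,
    ~~ b -> l' = [::] &
  exec (act (mv TC MoveL) ;; whilem (fun _ _ _ c _ => c == wcell (Val true))
    (act (fun r a b c d => Out r (keep a) (keep b) (None, MoveL) (keep d))))
    (Mem r0 ti0 tr0 (tape_at (bcells l) [::]) ta0)
    (2 * size l).+2
    (Mem r0 ti0 tr0
       (tape_at (bcells l') (if b then [:: wcell (Val false)] else [::])) ta0)].
Proof.
suff [b [l' [e sl bl E]]] : exists b l',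
  [/\ strip l = (if b then true :: l' else [::]), size l' <= size l,
    ~~ b -> l' = [::] &
  exec (whilem (fun _ _ _ c _ => c == wcell (Val true))
    (act (fun r a b c d => Out r (keep a) (keep b) (None, MoveL) (keep d))))
    (Mem r0 ti0 tr0 (tape_at (behead (bcells l)) [:: head None (bcells l)]) ta0)
    (2 * size l).+1
    (Mem r0 ti0 tr0
       (tape_at (bcells l') (if b then [:: wcell (Val false)] else [::])) ta0)].
  exists b, l'; split=> //; apply: exec_actseq; rewrite perform_mv /= zactL.
  by rewrite /= tape_at_blankr1.
elim: l => [|x l IH] /=.
  by exists false, [::]; split=> //; apply: exec_while0.
case: x => /=; last first.
  exists true, l; split=> //; apply: (@exec_le _ _ 1) => //; exact: exec_while0.
have [b [l' [e sl bl E]]] := IH.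
exists b, l'; split=> //; first by lia.
rewrite (_ : (2 * _).+1 = (2 * size l).+3); last by lia.
by apply: exec_while_act => //; sym_exec; rewrite tape_at_blankr1.
Qed.

Lemma all_bcells s : all isSome (bcells s).
Proof. by rewrite all_map; apply/allP. Qed.

Definition searching cd n s A : memory :=
  Mem (regs false false 0 false false) (tape_at [::] cd)
    (tape_at [::] (wcells (nseq n Free))) (tape_at [::] (bcells s)) (tape_at [::] (bcells A)).

Definition searched cd n lf y A : memory :=
  Mem (regs false false 0 (is_refuted lf) (is_refuted lf || nilp (next y)))
    (tape_at [::] cd) (tape_at [::] (wcells (nseq n Free))) (tape_at [::] (bcells (next y)))
    (tape_at [::] (bcells A)).

(** The hypothesis [size s <= size y] ensures that the choice tape is blank beyond the path taken,
    so that [next y] can be computed backwards from the head. *)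
Lemma branch_ex n (F : cnf n) s A lf y :
  follow (dtree F (nseq n Free) false 0) s = (lf, y) -> size s <= size y ->
  size A = n.+1 ->
  exec branch_prog (searching (code F) n s A)
    (9 * n.+1 * width F + 2 * size (code F) + 8 * n + 4 * size y + 30)
    (searched (code F) n lf y (add_leaf lf A)).
Proof.
move=> ef ssy sA;
have [|y' [lf' [l [r [q [ng [k [e [el al] sq eA E]]]]]]]] :=
  pass_ex F false 0 s [::] [::] (tape_at [::] (bcells A)) (size_nseq n Free).
  by rewrite count_nseq.
move: e E eA; rewrite ef => -[<- <-] {lf' y'}.
rewrite drop_oversize // catrevE cats0 => E eA.
have sl : size l <= size (code F).
  by have := congr1 size el; rewrite !catrevE !size_cat !size_rev /=; lia.
set c := count is_free q.
have cn : c <= size (bcells A) by rewrite size_map sA -sq (leq_trans (count_size _ _)).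
(* The summands are the costs of the successive stages of [branch_prog]. *)
apply: (@exec_le _ _ (((9 * n.+1 * width F).+1 + ((2 * size (code F) + 3)
  + ((2 * n).+1 + ((2 * n + 3) + ((2 * n.+1).+2 + ((2 * n.+1 + 3)
  + ((2 * size y).+2 + (2 * size y + 3).+1))))))).+1)); first by lia.
apply: exec_actseq; apply: exec_seq E _.
apply: exec_seq.
  by apply: (rewind_to (l := l) (r := r) (s := code F)) => //; [exact: al|lia].
have EF r0 ti0 tc0 := free_all_ex [::] [::] r0 ti0 tc0 cn.
rewrite -/c sq in EF; apply: exec_seq (EF _ _ _) _; apply: exec_seq.
  apply: (rewind_to (l := catrev (wcells (nseq n Free)) [::]) (r := [::])
    (s := wcells (nseq n Free))) => //.
  - by rewrite all_catrev all_wcells.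
  - by rewrite !catrevE !cats0 revK.
  - by rewrite catrevE cats0 size_rev size_map size_nseq.
rewrite /= /bcells -map_take -map_drop -/(bcells _) -/(bcells _).
pose v := catrev (bcells (take c A)) [::].
have av : all isSome v by rewrite all_catrev all_bcells.
have sv : size v = c.
  by rewrite /v catrevE cats0 size_rev size_map size_takel //
    -(size_map (fun b => wcell (Val b))).
have [v' [w' [eB av' sv' E']]] : exists v' w',
  [/\ catrev v' w' = bcells (add_leaf lf A), all isSome v', size v' <= n.+1 &
   exec (whilem carry_test (act carry) ;; act carry_stop)
     (Mem (regs (is_alive lf) ng k (is_refuted lf) false) (tape_at [::] (code F))
       (tape_at [::] (wcells (nseq n Free))) (tape_at (rev (bcells y)) [::])
       (tape_at v (bcells (drop c A))))
     ((2 * n.+1).+2)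
     (Mem (regs (is_alive lf) ng k (is_refuted lf) false) (tape_at [::] (code F))
       (tape_at [::] (wcells (nseq n Free))) (tape_at (rev (bcells y)) [::])
       (tape_at v' w'))].
  case: lf eA {ef} => [_|_|ng' q' [-> ->]].
  - exists v, (bcells (drop c A)); split=> //.
    + by rewrite /v !catrevE cats0 revK -map_cat cat_take_drop.
    + by rewrite sv (leq_trans cn) // size_map sA.
    + apply: (@exec_le _ _ (1 + 1)) => //; apply: exec_seq; first exact: exec_while0.
      by apply: exec_act; sym_exec.
  - exists v, (bcells (drop c A)); split=> //.
    + by rewrite /v !catrevE cats0 revK -map_cat cat_take_drop.
    + by rewrite sv (leq_trans cn) // size_map sA.
    + apply: (@exec_le _ _ (1 + 1)) => //; apply: exec_seq; first exact: exec_while0.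
      by apply: exec_act; sym_exec.
  - have [v' [A' [e' av' sv' E']]] := carry_ex ng (drop c A) k false
      (tape_at [::] (code F)) (tape_at [::] (wcells (nseq n Free)))
      (tape_at (rev (bcells y)) [::]) av.
    move: sv'; rewrite size_drop sv sA => sv'.
    exists v', (bcells (stop_at ng A')); split=> //.
    + by rewrite e' /= -/c /bcells map_cat /v !catrevE cats0 revK.
    + by move: cn; rewrite size_map sA; lia.
    + apply: (@exec_le _ _ ((2 * (n.+1 - c)).+1 + 1)); first by lia.
      rewrite size_drop sA in E'; apply: exec_seq E' _.
      by apply: exec_act; case: (A') => [|b w'] /=; sym_exec.
apply: exec_seq E' _; apply: exec_seq.
  by apply: (rewind_to (l := v') (r := w') (s := bcells (add_leaf lf A))) => //;
    rewrite ?eB //; lia.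
rewrite /bcells -map_rev -/(bcells _).
have [b [l' [eS sl' bl' ES]]] := strip_ex (rev y)
  (regs (is_alive lf) ng k (is_refuted lf) false) (tape_at [::] (code F))
  (tape_at [::] (wcells (nseq n Free))) (tape_at [::] (bcells (add_leaf lf A))).
rewrite size_rev in sl' ES.
apply: exec_seq ES _; apply: exec_actseq; sym_exec.
have enx : next y = if b then rcons (rev l') true else [::].
  by rewrite /next eS; case: (b); rewrite ?rev_cons.
apply: (rewind_to (l := bcells l') (r := if b then [:: wcell (Val true)] else [::])).
- by rewrite /get; case: (b).
- exact: all_bcells.
- reflexivity.
- rewrite /searched /= enx; case: b {eS enx} bl' => [_|->] //=.
  rewrite (_ : nilp (rcons _ _) = false); last by case: (rev l').
  congr Mem.
  by rewrite catrevE -map_rev /bcells map_rcons cats1.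
- by rewrite size_map; lia.
Qed.

(** * The search over all branches *)

Fixpoint leaves (t : tree) : nat :=
  if t is Br t0 t1 then leaves t0 + leaves t1 else 1.
Fixpoint depth (t : tree) : nat :=
  if t is Br t0 t1 then (maxn (depth t0) (depth t1)).+1 else 0.
Fixpoint has_refuted (t : tree) : bool :=
  match t with
  | Leaf lf => is_refuted lf | Br t0 t1 => has_refuted t0 || has_refuted t1
  end.
Fixpoint accum (t : tree) (A : seq bool) : seq bool :=
  match t with
  | Leaf lf => add_leaf lf A | Br t0 t1 => accum t1 (accum t0 A)
  end.

Lemma size_accum t A : size (accum t A) = size A.
Proof.
by elim: t A => [lf|t0 IH0 t1 IH1] A /=; rewrite ?size_add_leaf ?IH1 ?IH0.
Qed.

Lemma size_follow t s : size (follow t s).2 <= depth t.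
Proof.
elim: t s => //= t0 IH0 t1 IH1 s; rewrite ltnS leq_max.
by case: (head false s); rewrite ?IH0 ?IH1 ?orbT.
Qed.

Definition search_prog : mach := whilem (fun r _ _ _ _ => ~~ dn r) branch_prog.

Section Search.
Variables (n : nat) (F : cnf n) (B : nat).
Let T := dtree F (nseq n Free) false 0.
Hypothesis branch_time :
  9 * n.+1 * width F + 2 * size (code F) + 8 * n + 4 * depth T + 30 <= B.

Lemma search_step s A U m' : size s <= size (follow T s).2 -> size A = n.+1 ->
  exec search_prog
    (searched (code F) n (follow T s).1 (follow T s).2 (add_leaf (follow T s).1 A))
    U m' ->
  exec search_prog (searching (code F) n s A) (B.+1 + U) m'.
Proof.
move=> ss sA; have := size_follow T s.
case ef : (follow T s) ss => [lf y] /= ss dy E.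
by apply: exec_whileS E => //; apply: exec_le (branch_ex ef ss sA); lia.
Qed.

Lemma next_rcons_false p : next (rcons p false) = rcons p true.
Proof. by rewrite /next rev_rcons /= rev_cons revK. Qed.

Lemma next_rcons_true p : next (rcons p true) = next p.
Proof. by rewrite /next rev_rcons. Qed.

(** With the next lemma, this drives the traversal: finishing the left child of [p] starts the
    search in the right child, and finishing the right child amounts to finishing [p]. *)
Lemma searched_rcons_false lf p A : ~~ is_refuted lf ->
  searched (code F) n lf (rcons p false) A = searching (code F) n (rcons p true) A.
Proof.
rewrite /searched /searching next_rcons_false => /negPf->.
by rewrite (_ : nilp _ = false) //; case: p.
Qed.

Lemma searched_rcons_true lf p A :
  searched (code F) n lf (rcons p true) A = searched (code F) n lf p A.
Proof. by rewrite /searched next_rcons_true. Qed.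

Lemma follow_rcons p t0 t1 :
  (forall s', follow T (p ++ s') = extend p (follow (Br t0 t1) s')) ->
  forall (b : bool) s',
    follow T (rcons p b ++ s') = extend (rcons p b) (follow (if b then t1 else t0) s').
Proof. by move=> H b s'; rewrite cat_rcons H /extend /= cat_rcons. Qed.

(* Started on a choice string that leads to the first leaf below the node at
   [p], the search visits the whole subtree there and comes back with the
   successor of [p]. *)
Lemma search_subtree t p s A U m' :
  (forall s', follow T (p ++ s') = extend p (follow t s')) ->
  follow T s = follow T p -> size s <= size p -> size A = n.+1 ->
  ~~ has_refuted t ->
  exec search_prog (searched (code F) n Dead p (accum t A)) U m' ->
  exec search_prog (searching (code F) n s A) (leaves t * B.+1 + U) m'.
Proof.
elim: t p s A U => [lf|t0 IH0 t1 IH1] p s A U H es ss sA /=.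
  move=> nr E; rewrite mul1n.
  have ep : follow T s = (lf, p) by rewrite es -[p]cats0 H /extend /= cats0.
  apply: search_step; rewrite ?ep //=.
  by move: nr E; case: (lf).
rewrite negb_or => /andP[nr0 nr1] E; rewrite mulnDl -addnA.
have H' := follow_rcons H.
apply: (IH0 (rcons p false) s A _ (H' false)) => //.
- rewrite es -[p in LHS]cats0 -[rcons _ _]cats0 H (H' false).
  by rewrite /extend /= cat_rcons.
- by rewrite size_rcons leqW.
rewrite searched_rcons_false //.
apply: (IH1 (rcons p true) _ _ _ (H' true)) => //; first by rewrite size_accum.
by rewrite searched_rcons_true.
Qed.

(** Subtrees to the left of the first refuted leaf are traversed in full; that leaf sets [dn] and
    ends the loop. The register [rej] then forces the answer, whatever [A'] has become. *)
Lemma search_refuted t p s A :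
  (forall s', follow T (p ++ s') = extend p (follow t s')) ->
  follow T s = follow T p -> size s <= size p -> size A = n.+1 ->
  has_refuted t ->
  exists y A', size A' = n.+1 /\ forall U m',
    exec search_prog (searched (code F) n Refuted y A') U m' ->
    exec search_prog (searching (code F) n s A) (leaves t * B.+1 + U) m'.
Proof.
elim: t p s A => [lf|t0 IH0 t1 IH1] p s A H es ss sA /=.
  move=> rf; exists p, A; split=> // U m' E; rewrite mul1n.
  have ep : follow T s = (lf, p) by rewrite es -[p]cats0 H /extend /= cats0.
  apply: search_step; rewrite ?ep //=.
  by move: rf E; case: (lf).
have H' := follow_rcons H.
have es' : follow T s = follow T (rcons p false).
  rewrite es -[p in LHS]cats0 -[rcons _ _]cats0 H (H' false).
  by rewrite /extend /= cat_rcons.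
have ss' b : size s <= size (rcons p b) by rewrite size_rcons leqW.
case: (boolP (has_refuted t0)) => [r0 _|nr0 r1].
  have [y [A' [sA' E]]] := IH0 _ _ _ (H' false) es' (ss' _) sA r0.
  exists y, A'; split=> // U m' E'; apply: exec_le (E _ _ E').
  by rewrite mulnDl -addnA addnCA leq_addl.
have sA0 : size (accum t0 A) = n.+1 by rewrite size_accum.
have [y [A' [sA' E]]] := IH1 _ _ _ (H' true) erefl (leqnn _) sA0 r1.
exists y, A'; split=> // U m' E'; rewrite mulnDl -addnA.
apply: (search_subtree (H' false)) => //.
by rewrite searched_rcons_false //; apply: E.
Qed.

End Search.

(** * Initialization, main program and verdict *)

Definition alloc : action := fun r a b c d =>
  Out r (None, MoveR) (wcell Free, MoveR) (keep c) (wcell (Val false), MoveR).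

Definition init_prog : mach :=
  whilem (fun _ a _ _ _ => a == scell Tick) (act alloc) ;;
  act (fun r a b c d => Out r (keep a) (keep b) (keep c) (keep (wcell (Val false)))) ;;
  rewind TR ;; rewind TA.

(** [sg] and [sat] are reused as a shift register. The counter is read from its least significant
    bit, so they end up with its two top bits; a counter of n+1 bits is at least 2^(n-1) exactly
    when one of these is set. *)
Definition last_two : action := fun r a b c d =>
  let: Reg sg len pnd _ sp cm ok ng k rj dn := r in
  Out (Reg (d == wcell (Val true)) len pnd sg sp cm ok ng k rj dn)
    (keep a) (keep b) (keep c) (d, MoveR).

Definition main_prog : mach :=
  init_prog ;; search_prog ;; whilem (nonblank TA) (act last_two).

Definition answer (r : reg) : bool := ~~ rej r && (sg r || sat r).

(** The ticks are erased while they are counted off, so that every later rewinding of the input tape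
    stops at the first clause. *)
Lemma alloc_ex n li lr la r0 ri tc0 : head None ri != scell Tick ->
  exec (whilem (fun _ a _ _ _ => a == scell Tick) (act alloc))
    (Mem r0 (tape_at li (nseq n (scell Tick) ++ ri)) (tape_at lr [::]) tc0 (tape_at la [::]))
    (2 * n).+1
    (Mem r0 (tape_at (nseq n None ++ li) ri) (tape_at (nseq n (wcell Free) ++ lr) [::]) tc0
       (tape_at (nseq n (wcell (Val false)) ++ la) [::])).
Proof.
move=> hd; elim: n li lr la => [|n IH] li lr la; first by apply: exec_while0.
rewrite (_ : (2 * _).+1 = (2 * n).+3); last by lia.
apply: exec_while_act => //; sym_exec.
have nS T (x : T) s : x :: nseq n x ++ s = nseq n x ++ x :: s.
  by elim: n {IH} => //= n ->.
by rewrite !nS; apply: IH.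
Qed.

Lemma init_ex n (F : cnf n) :
  exec init_prog
    (Mem (regs false false 0 false false) (tape_at [::] (nseq n (scell Tick) ++ code F))
       (tape_at [::] [::]) (tape_at [::] [::]) (tape_at [::] [::]))
    (6 * n + 8) (searching (code F) n [::] (nseq n.+1 false)).
Proof.
apply: (@exec_le _ _ ((2 * n).+1 + ((2 * n + 3) + (2 * n + 3)).+1)); first by lia.
have hd : head None (code F) != scell Tick by case: (F).
apply: exec_seq (alloc_ex _ _ _ _ _ _ hd) _; rewrite !cats0 tape_at_nblankl.
have eb m (x : cell) : catrev (nseq m x) [::] = nseq m x.
  by rewrite catrevE cats0 rev_nseq.
have wn : nseq n (wcell Free) = wcells (nseq n Free) by rewrite /wcells map_nseq.
have bn : bcells (nseq n.+1 false) = nseq n.+1 (wcell (Val false)).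
  by rewrite /bcells map_nseq.
apply: exec_actseq; sym_exec; apply: exec_seq.
  apply: (rewind_to (l := nseq n (wcell Free)) (r := [::])
    (s := nseq n (wcell Free))) => //; first by rewrite all_nseq orbT.
  by rewrite size_nseq.
apply: (rewind_to (l := nseq n (wcell (Val false))) (r := [:: wcell (Val false)])
    (s := nseq n.+1 (wcell (Val false)))) => //.
- by rewrite all_nseq orbT.
- by rewrite catrevE rev_nseq -[[:: _]]/(nseq 1 _) -nseqD addn1.
- by rewrite /put /searching bn wn.
- by rewrite size_nseq.
Qed.

Lemma last_two_ex A len0 pnd0 sp cm o ng k rj d0 ti0 tr0 tc0 s0 s1 l :
  exists m',
  exec (whilem (nonblank TA) (act last_two))
    (Mem (Reg s0 len0 pnd0 s1 sp cm o ng k rj d0) ti0 tr0 tc0 (tape_at l (bcells A)))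
    (2 * size A).+1 m'
  /\ rg m' = let: (x, y) := foldl (fun z b => (b, z.1)) (s0, s1) A in
             Reg x len0 pnd0 y sp cm o ng k rj d0.
Proof.
elim: A s0 s1 l => [|b A IH] s0 s1 l.
  by eexists; split; [apply: exec_while0 | ].
have [m' [E e]] := IH b s0 (wcell (Val b) :: l).
exists m'; split=> //; rewrite (_ : (2 * _).+1 = (2 * size A).+3) /=; last by lia.
by apply: exec_while_act => //; sym_exec; case: (b) E.
Qed.

Lemma main_ex n (F : cnf n) (T := dtree F (nseq n Free) false 0)
    (B := 9 * n.+1 * width F + 2 * size (code F) + 8 * n + 4 * depth T + 30) :
  exists m',
  exec main_prog
    (Mem (regs false false 0 false false) (tape_at [::] (nseq n (scell Tick) ++ code F))
       (tape_at [::] [::]) (tape_at [::] [::]) (tape_at [::] [::]))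
    (6 * n + 8 + (leaves T * B.+1 + 1 + (2 * n.+1).+1)) m'
  /\ answer (rg m') = ~~ has_refuted T &&
       (let: (x, y) := foldl (fun z b => (b, z.1)) (false, false)
                         (accum T (nseq n.+1 false)) in x || y).
Proof.
have sA : size (nseq n.+1 false) = n.+1 by rewrite size_nseq.
have H s' : follow T ([::] ++ s') = extend [::] (follow T s') by case: follow.
have loop m0 m' V : exec search_prog (searching (code F) n [::] (nseq n.+1 false))
    (leaves T * B.+1 + 1) m0 ->
  exec (whilem (nonblank TA) (act last_two)) m0 V m' -> V <= (2 * n.+1).+1 ->
  exec main_prog
    (Mem (regs false false 0 false false) (tape_at [::] (nseq n (scell Tick) ++ code F))
       (tape_at [::] [::]) (tape_at [::] [::]) (tape_at [::] [::]))
    (6 * n + 8 + (leaves T * B.+1 + 1 + (2 * n.+1).+1)) m'.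
  move=> E1 E2 le; apply: exec_seq (init_ex F) _; apply: exec_seq E1 _.
  exact: exec_le E2.
case: (boolP (has_refuted T)) => rf.
  have [y [A' [sA' E]]] := search_refuted (leqnn B) H erefl (leqnn _) sA rf.
  have [m' [E' e]] := last_two_ex A' (to_ctr 0) (to_ctr 0) false false false false
    (to_ctr 0) true true (tape_at [::] (code F)) (tape_at [::] (wcells (nseq n Free)))
    (tape_at [::] (bcells (next y))) false false [::].
  exists m'; split; last by rewrite /answer e; case: (foldl _ _ _).
  apply: loop E' _; last by rewrite sA'.
  by apply: E; apply: exec_while0.
have [m' [E' e]] := last_two_ex (accum T (nseq n.+1 false)) (to_ctr 0) (to_ctr 0)
  false false false false (to_ctr 0) false true (tape_at [::] (code F))
  (tape_at [::] (wcells (nseq n Free))) (tape_at [::] [::]) false false [::].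
exists m'; split; last by rewrite /answer e; case: (foldl _ _ _).
apply: loop E' _; last by rewrite size_accum size_nseq.
by apply: (search_subtree (leqnn B) H) => //; apply: exec_while0.
Qed.

(** * Counting satisfying assignments along the tree *)

Section Counting.
Variable n : nat.
Implicit Types (p q : seq wsym) (a : {ffun 'I_n -> bool}) (i : 'I_n).

(** The subcube fixed by the [Val] cells. A pending cell imposes nothing until [settle true] turns
    its value into a real one. *)
Definition cube p a : bool :=
  [forall i : 'I_n, if nth Free p i is Val b then a i == b else true].

Definition num_in p (Q : pred {ffun 'I_n -> bool}) : nat :=
  #|[pred a | cube p a && Q a]|.

Lemma eq_num_in p p' (Q Q' : pred {ffun 'I_n -> bool}) :
  cube p =1 cube p' -> (forall a, cube p a -> Q a = Q' a) ->
  num_in p Q = num_in p' Q'.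
Proof.
move=> ep eQ; apply: eq_card => a; rewrite !inE -ep.
by case E: (cube p a) => //=; apply: eQ.
Qed.

Definition is_val (w : wsym) : bool := if w is Val _ then true else false.

Lemma eq_cube p p' a :
  (forall i, is_val (nth Free p i) || is_val (nth Free p' i) ->
     nth Free p i = nth Free p' i) -> cube p a = cube p' a.
Proof.
move=> e; apply: eq_forallb => i; have := e i.
by case: (nth _ p i) => [|b|b]; case: (nth _ p' i) => [|c|c] //= /(_ isT) // [->].
Qed.

Lemma cube_set p i b a : ~~ is_val (nth Free p i) ->
  cube (set_nth Free p i (Val b)) a = (a i == b) && cube p a.
Proof.
move=> nv; apply/forallP/andP => [H|[/eqP ai /forallP H] j].
  split; first by have := H i; rewrite nth_set_nth /= eqxx.
  apply/forallP => j; have := H j; rewrite nth_set_nth /=.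
  by case: ifP => // /eqP eij; move: nv; rewrite -eij; case: (nth _ _ _).
rewrite nth_set_nth /=; case: ifP => [/eqP /val_inj ->|_]; last exact: H.
by rewrite ai.
Qed.

Lemma num_in_split p i Q : ~~ is_val (nth Free p i) ->
  num_in p Q = num_in (set_nth Free p i (Val true)) Q
             + num_in (set_nth Free p i (Val false)) Q.
Proof.
move=> nv; rewrite /num_in -[LHS](cardID [pred a : {ffun _} | a i]); congr (_ + _);
  apply: eq_card => a; rewrite !inE cube_set //;
  by case: (a i); rewrite ?andbT ?andbF.
Qed.

Lemma set_nth_mid (u : seq wsym) x w y :
  set_nth Free (u ++ x :: w) (size u) y = u ++ y :: w.
Proof. by elim: u => //= z u ->. Qed.

Lemma num_in_split_mid u x w Q : size (u ++ x :: w) = n -> ~~ is_val x ->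
  num_in (u ++ x :: w) Q = num_in (u ++ Val true :: w) Q
                         + num_in (u ++ Val false :: w) Q.
Proof.
move=> sp nv; have lt : size u < n by rewrite -sp size_cat /= addnS ltnS leq_addr.
by rewrite (@num_in_split _ (Ordinal lt)) /= ?nth_cat ?ltnn ?subnn // !set_nth_mid.
Qed.

Lemma num_in_all p : size p = n -> count is_pend p = 0 ->
  num_in p predT = 2 ^ count is_free p.
Proof.
move=> sp cp; pose f w : pred bool := if w is Val b then pred1 b else predT.
have -> : num_in p predT = #|family (fun i : 'I_n => f (nth Free p i))|.
  apply: eq_card => a; rewrite inE /= andbT.
  apply/forallP/familyP => H i; have := H i; rewrite /f;
    by case: (nth _ _ _) => [|b|b].
rewrite card_family; pose g w := if is_val w then 1 else 2.
have -> : [seq #|f (nth Free p i)| | i : 'I_n] = map g p.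
  transitivity (map g (map (nth Free p) (iota 0 n))); last first.
    by rewrite -/(mkseq _ _) -sp mkseq_nth.
  rewrite -val_enum_ord -!map_comp /image_mem enumT; apply: eq_map => i /=.
  rewrite /f /g; case: (nth _ _ _) => [|b|b] /=; rewrite ?card1 //;
    exact: card_bool.
elim: p {sp} cp => //= -[|b|b] p IH //= /IH ->; rewrite /g /= ?mul1n //.
by rewrite expnS.
Qed.

Lemma nth_map_settle b p i : nth Free (map (settle b) p) i = settle b (nth Free p i).
Proof.
case: (ltnP i (size p)) => h; first by rewrite (nth_map Free).
by rewrite !nth_default ?size_map.
Qed.

Lemma map_settle_clean b p : count is_pend p = 0 -> map (settle b) p = p.
Proof. by elim: p => //= -[|v|v] p IH //= /IH ->. Qed.

Lemma lits_true (C : clause n) p : (lits C p true).2.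
Proof. by elim: C p => //= l C IH p; case: (litw _ _) => w t; apply: IH. Qed.

Lemma cube_lits (C : clause n) p st a : cube (lits C p st).1 a = cube p a.
Proof.
elim: C p st => //= l C IH p st; case e: (litw _ _) => [w t]; rewrite IH.
apply: eq_cube => i; rewrite nth_set_nth /=; case: ifP => // /eqP eil.
by move: e; rewrite eil; case: (nth _ _ _) => [|c|c] //= [<- _].
Qed.

Lemma set_nth_id p (i : nat) : i < size p -> set_nth Free p i (nth Free p i) = p.
Proof.
move=> lt; rewrite set_nthE lt -drop_nth //; exact: cat_take_drop.
Qed.

(** Stated through [settle true] so that the induction can go past literals already read, whose
    pending cells then count as assigned. The marked cells describe exactly the part of the cube
    where the clause fails; a raised flag means that this part is empty. *)
Lemma lits_falsify (C : clause n) p a : size p = n ->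
  if (lits C p false).2 then
    is_true (cube (map (settle true) p) a ==> sat_clause a C)
  else cube (map (settle true) (lits C p false).1) a
       = cube (map (settle true) p) a && ~~ sat_clause a C.
Proof.
elim: C p => [|[i b] C IH] p sp /=; first by rewrite andbT.
rewrite [sat_literal _ _]/(a i == b) -/(sat_clause a C).
have cv c : settle true (nth Free p i) = Val c ->
    cube (map (settle true) p) a -> a i = c.
  by move=> e /forallP/(_ i); rewrite nth_map_settle e => /eqP.
have lt : i < size p by rewrite sp.
have old c : settle true (nth Free p i) = Val c ->
    if (lits C p (c == b)).2 then
      is_true (cube (map (settle true) p) a ==> (a i == b) || sat_clause a C)
    else cube (map (settle true) (lits C p (c == b)).1) a
       = cube (map (settle true) p) a && ~~ ((a i == b) || sat_clause a C).
  move=> /cv aic; case: eqP => [<-|/eqP cb].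
    by rewrite lits_true; apply/implyP => /aic ->; rewrite eqxx.
  have := IH p sp; case: ifP => _ => [/implyP H|->].
    by apply/implyP => h; rewrite (H h) orbT.
  by case E: (cube _ _) => //=; rewrite (aic E) (negPf cb).
have idp : set_nth Free p i (nth Free p i) = p by apply: set_nth_id.
case ew : (nth Free p i) idp old => [|c|c] /= idp old.
- have := IH (set_nth Free p i (Pend (~~ b))) (size_set_var _ _ sp).
  have -> : cube (map (settle true) (set_nth Free p i (Pend (~~ b)))) a
      = (a i == ~~ b) && cube (map (settle true) p) a.
    rewrite -cube_set ?nth_map_settle ?ew //; apply: eq_cube => j _.
    rewrite nth_map_settle !nth_set_nth /=; case: ifP => // _.
    by rewrite nth_map_settle.
  case: ifP => _.
    by case: (a i); case: (b); case: cube; case: sat_clause.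
  by move=> ->; case: (a i); case: (b); rewrite /= ?andbF.
- by rewrite idp; apply: old.
- by rewrite idp; apply: old.
Qed.

Local Open Scope ring_scope.

Definition clean p : Prop := size p = n /\ count is_pend p = 0%N.

Lemma num_in_cons (C : clause n) p (Q : pred {ffun 'I_n -> bool}) : clean p ->
  let: (q, st) := lits C p false in
  (num_in p (fun a => sat_clause a C && Q a) : int)
  = if st then num_in p Q : int
    else (num_in p Q : int) - (num_in (map (settle true) q) Q : int).
Proof.
move=> [sp cp]; have H a := lits_falsify C a sp.
case: (lits C p false) H => q st /= H.
rewrite map_settle_clean // in H.
case: st H => H.
  congr Posz; apply: eq_num_in => // a ca.
  by have := H a; rewrite ca /= => ->.
apply/eqP; rewrite -subr_eq opprK -PoszD; apply/eqP; congr Posz.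
rewrite /num_in -[RHS](cardID [pred a : {ffun _} | sat_clause a C]); congr (_ + _)%N;
  apply: eq_card => a; rewrite !inE /= ?H;
  by case: (cube p a); case: sat_clause; case: (Q a).
Qed.

Definition leaf_value (lf : leaf) : int :=
  if lf is Alive ng q then (-1) ^+ ng * (2 ^ count is_free q)%N%:Z else 0.
Fixpoint tree_sum (t : tree) : int :=
  match t with Leaf lf => leaf_value lf | Br t0 t1 => tree_sum t0 + tree_sum t1 end.

(** The branches partition the cube, and the only contribution lost is that of the branch falsifying
    every literal, unless [o] already holds. Branching over a short clause therefore yields the same
    difference as the subtraction for a long one, and [num_in_cons] serves both. *)
Lemma split_tree_sum (K : seq wsym -> tree) (f : int) Q d q o :
  let T := split_tree d q o (fun q' o' => if o' then K q' else Leaf Dead) in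
  (forall q', clean q' -> ~~ has_refuted (K q') ->
     tree_sum (K q') = f * (num_in q' Q : int)) ->
  count is_pend d = 0%N -> (size d + size q)%N = n -> ~~ has_refuted T ->
  tree_sum T = f * ((num_in (rev d ++ map (settle false) q) Q : int)
    - (if o then 0 else num_in (rev d ++ map (settle true) q) Q : int)).
Proof.
move=> /= HK; elim: q d o => [|w q IH] d o cd sz /=.
  case: o => [nr|_] /=; last by rewrite cats0 subrr mulr0.
  rewrite cats0 subr0; apply: HK => //; split; last by rewrite count_rev.
  by rewrite size_rev -sz addn0.
rewrite /= in sz; have sz' x : (size (x :: d) + size q)%N = n by rewrite /= addSnnS.
have rc x u : rev (x :: d) ++ u = rev d ++ x :: u by rewrite rev_cons cat_rcons.
case: w => [|v|v] /=; try by move=> nr; rewrite IH // !rc.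
rewrite negb_or => /andP[nr0 nr1]; rewrite !IH // !rc subr0.
have -> : num_in (rev d ++ Free :: map (settle false) q) Q =
   (num_in (rev d ++ Val (~~ v) :: map (settle false) q) Q
    + num_in (rev d ++ Val v :: map (settle false) q) Q)%N.
  rewrite num_in_split_mid ?size_cat ?size_rev /= ?size_map //.
  by case: (v); rewrite // addnC.
by rewrite PoszD -mulrDr -addrA.
Qed.

Lemma clean_settle b p : size p = n -> clean (map (settle b) p).
Proof. by move=> sp; split; rewrite ?size_map ?count_settle. Qed.

Lemma dtree_sum (F : cnf n) p ng k : clean p -> ~~ has_refuted (dtree F p ng k) ->
  tree_sum (dtree F p ng k)
  = (-1) ^+ ng * (num_in p (fun a => sat_cnf a F) : int).
Proof.
elim: F p ng k => [|C F IH] p ng k cp.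
  by move=> _ /=; rewrite -num_in_all //; case: cp.
rewrite [dtree _ _ _ _]/= /node.
have -> : num_in p (fun a => sat_cnf a (C :: F)) =
  num_in p (fun a => sat_clause a C && sat_cnf a F) by [].
have := num_in_cons C (fun a => sat_cnf a F) cp.
have := size_lits C false cp.1.
have e0 Q : num_in (map (settle false) (lits C p false).1) Q = num_in p Q.
  apply: eq_num_in => // a; rewrite -(cube_lits C p false).
  by apply: eq_cube => i; rewrite nth_map_settle; case: (nth _ _ _).
case: (lits C p false) e0 => q st /= e0 sq ->.
case: ifP => _; first by move=> nr; rewrite IH ?e0 //; apply: clean_settle.
case: ifP => _ /=.
  rewrite negb_or => /andP[nr0 nr1]; rewrite !IH ?e0 //; try exact: clean_settle.
  by case: (ng); rewrite /= ?expr1 ?expr0; ring.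
case: ifP => [//|_] nr.
rewrite (@split_tree_sum (fun q' => dtree F q' ng (k + (1 < count is_pend q)))
  ((-1) ^+ ng) (fun a => sat_cnf a F)) //=; last by move=> *; apply: IH.
by rewrite e0.
Qed.
Local Close Scope ring_scope.

(** Pairwise disjointness, relative to the variables [V] still available. Each clause only has to
    imply a disjunction of two literals on distinct variables, which is all that an upper bound on
    the number of models requires. *)
Fixpoint indep (V : {set 'I_n}) (D : cnf n) : Prop :=
  if D is C :: D' then
    exists i j b c,
    [/\ i \in V, j \in V, i != j,
      (forall a, sat_clause a C -> (a i == b) || (a j == c)) &
      indep (V :\ i :\ j) D']
  else True.

Lemma indep_sub (V V' : {set 'I_n}) (D : cnf n) : V \subset V' -> indep V D -> indep V' D.
Proof.
elim: D V V' => //= C D IH V V' sV [i [j [b [c [iV jV ij H iD]]]]].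
exists i, j, b, c; split=> //; try exact: (subsetP sV).
by apply: IH iD; do 2![apply: setSD].
Qed.

Definition free_set p : {set 'I_n} := [set i : 'I_n | ~~ is_val (nth Free p i)].

Lemma count_free_set p i b : size p = n -> is_free (nth Free p i) ->
  (count is_free (set_nth Free p i (Val b))).+1 = count is_free p.
Proof.
move=> sp; have lt : i < size p by rewrite sp.
rewrite -{3}(cat_take_drop i p) (drop_nth Free lt) set_nthE lt !count_cat /=.
by case: (nth _ _ _) => //= *; lia.
Qed.

Lemma clean_set p i b : clean p -> is_free (nth Free p i) ->
  clean (set_nth Free p i (Val b)).
Proof.
move=> [sp cp] fi; split; first exact: size_set_var.
have lt : i < size p by rewrite sp.
move: cp; rewrite -{1}(cat_take_drop i p) (drop_nth Free lt) set_nthE lt.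
by rewrite !count_cat /=; lia.
Qed.

Lemma clean_free p i : clean p -> i \in free_set p -> is_free (nth Free p i).
Proof.
move=> [sp cp]; rewrite inE => nv; have lt : i < size p by rewrite sp.
have : ~~ has is_pend p by rewrite has_count cp.
by move/hasPn/(_ _ (mem_nth Free lt)); case: (nth _ _ _) nv.
Qed.

Lemma free_nval w : is_free w -> ~~ is_val w.
Proof. by case: w. Qed.

Lemma num_in_sub p (Q Q' : pred {ffun 'I_n -> bool}) :
  (forall a, cube p a -> Q a -> Q' a) -> num_in p Q <= num_in p Q'.
Proof.
move=> H; apply/subset_leq_card/subsetP => a; rewrite !inE.
by move=> /andP[ca Qa]; rewrite ca /= H.
Qed.

(** The two variables of the first clause cut the cube into four equal parts. One of them has no
    model, and the other three leave the variables of the remaining clauses free. *)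
Lemma indep_bound (D : cnf n) (V : {set 'I_n}) p : indep V D -> clean p -> V \subset free_set p ->
  4 ^ size D * num_in p (fun a => sat_cnf a D)
  <= 3 ^ size D * 2 ^ count is_free p.
Proof.
elim: D V p => [|C D IH] V p /=.
  by move=> _ [sp cp] _; rewrite -num_in_all // !mul1n; apply: num_in_sub.
move=> [i [j [b [c [iV jV ij H iD]]]]] cp sV.
have fi : is_free (nth Free p i) by apply: clean_free cp (subsetP sV i iV).
have fj : is_free (nth Free p j) by apply: clean_free cp (subsetP sV j jV).
pose pi x := set_nth Free p i (Val x).
have fij x : is_free (nth Free (pi x) j).
  by rewrite nth_set_nth /= eq_sym val_eqE (negPf ij).
pose pij x y := set_nth Free (pi x) j (Val y).
have cpi x : clean (pi x) by apply: clean_set.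
have cpij x y : clean (pij x y) by apply: clean_set.
have IHxy x y : 4 ^ size D * num_in (pij x y) (fun a => sat_cnf a (C :: D))
    <= ((x == b) || (y == c)) * (3 ^ size D * 2 ^ (count is_free p - 2)).
  have cf : count is_free (pij x y) = count is_free p - 2.
    by rewrite -(count_free_set x cp.1 fi) -(count_free_set y (cpi x).1 (fij x)) subn2.
  case: (boolP (_ || _)) => xy; last first.
    rewrite (_ : num_in _ _ = 0) ?muln0 //; apply: eq_card0 => a; rewrite !inE.
    rewrite !cube_set ?free_nval //; apply/negP.
    move=> /andP[/andP[/eqP aj /andP[/eqP ai _]] /andP[/H]].
    by rewrite ai aj (negPf xy).
  rewrite mul1n -cf; apply: leq_trans (IH _ (pij x y) iD (cpij _ _) _).
    by rewrite leq_mul2l num_in_sub ?orbT // => a _ /andP[].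
  apply/subsetP => l; rewrite !inE => /and3P[lj li lV].
  have := subsetP sV l lV; rewrite inE !nth_set_nth /= !val_eqE.
  by rewrite (negPf lj) nth_set_nth /= val_eqE (negPf li).
rewrite (num_in_split _ (free_nval fi)).
rewrite (num_in_split _ (free_nval (fij true))) (num_in_split _ (free_nval (fij false))).
have c2 : 2 <= count is_free p.
  by rewrite -(count_free_set true cp.1 fi) -(count_free_set true (cpi true).1 (fij true)).
have -> : 2 ^ count is_free p = 4 * 2 ^ (count is_free p - 2).
  by rewrite -(expnD 2 2) subnKC.
have := IHxy true true; have := IHxy true false.
have := IHxy false true; have := IHxy false false.
rewrite /pij /pi !expnS; set N := 3 ^ _ * _.
rewrite -!mulnA [3 ^ _ * _]mulnCA -/N; case: (b); case: (c) => /=; lia.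
Qed.

Lemma is_val_lits (C : clause n) p st (i : nat) :
  is_val (nth Free (lits C p st).1 i) = is_val (nth Free p i).
Proof.
elim: C p st => //= l C IH p st; case e: (litw _ _) => [w t]; rewrite IH.
rewrite nth_set_nth /=; case: ifP => // /eqP ->.
by move: e; case: (nth _ _ _) => [|v|v] /= [<- _].
Qed.

(** Independence depends on which variables are assigned, not on their values. All branches of a
    split assign the same ones, those assigned by [settle true], hence the comparison through
    [map is_val]. *)
Lemma split_tree_refuted d q o K : has_refuted (split_tree d q o K) ->
  exists q' o',
  [/\ has_refuted (K q' o'), size q' = size d + size q,
    map is_val q' = map is_val (rev d) ++ map is_val (map (settle true) q) &
    count is_pend q' = count is_pend d].
Proof.
elim: q d o => [|w q IH] d o /=.
  move=> h; exists (rev d), o; split=> //; first by rewrite size_rev addn0.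
    by rewrite cats0.
  by rewrite count_rev.
have step x o' : ~~ is_pend x -> has_refuted (split_tree (x :: d) q o' K) ->
  exists q' o',
  [/\ has_refuted (K q' o'), size q' = size d + (size q).+1,
    map is_val q' = map is_val (rev d)
      ++ is_val x :: map is_val (map (settle true) q) &
    count is_pend q' = count is_pend d].
  move=> npx /IH[q' [o2 [h s m c]]]; exists q', o2; split=> //.
  - by rewrite s addSnnS.
  - by rewrite m rev_cons map_rcons cat_rcons.
  - by rewrite c /= (negPf npx).
by case: w => [|v|v] /=; [exact: step|exact: step|case/orP; exact: step].
Qed.

Lemma eq_free_set p p' : map is_val p = map is_val p' -> free_set p = free_set p'.
Proof.
move=> e; have sz : size p = size p' by rewrite -(size_map is_val) e size_map.
apply/setP => i; rewrite !inE; case: (ltnP i (size p)) => h; last first.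
  by rewrite !nth_default // -sz.
by rewrite -!(nth_map Free false is_val) -?sz // e.
Qed.

(* The two literals whose cells [lits] has just marked. *)
Lemma two_pending (C : clause n) p : clean p -> size C <= 2 ->
  (lits C p false).2 = false -> 1 < count is_pend (lits C p false).1 ->
  exists i j b c, [/\ i \in free_set p, j \in free_set p, i != j,
    (forall a, sat_clause a C -> (a i == b) || (a j == c)) &
    is_pend (nth Free (lits C p false).1 i)
    && is_pend (nth Free (lits C p false).1 j)].
Proof.
move=> [sp cp]; case: C => [|[i b] [|[j c] []]] //= _; first by rewrite cp.
  have := count_pend_litw (i, b) sp; rewrite /= cp.
  by case: (nth _ _ _) => [|v|v] /= ->.
have := count_pend_litw (i, b) sp; rewrite /= cp.
have := size_set_var i (litw b (nth Free p i)).1 sp.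
case ei : (nth Free p i) => [|v|v] /= s1 c1; rewrite ?c1.
- have := count_pend_litw (j, c) s1; rewrite /= c1.
  case ej : (nth Free _ j) => [|v|v] /= e; rewrite ?e //.
  have ji : (j == i :> nat) = false.
    by move: ej; rewrite nth_set_nth /=; case: ifP.
  move: ej; rewrite nth_set_nth /= ji => ej _ _.
  exists i, j, b, c; split; rewrite ?inE ?ei ?ej //.
  + by apply/eqP => ij; rewrite ij eqxx in ji.
  + by move=> a; rewrite /sat_clause /= orbF.
  + by rewrite !nth_set_nth /= eqxx eq_sym ji nth_set_nth /= eqxx.
- have := count_pend_litw (j, c) s1; rewrite /= c1.
  by case: (nth _ _ j) => [|w|w] /= ->.
- have := count_pend_litw (j, c) s1; rewrite /= c1.
  by case: (nth _ _ j) => [|w|w] /= ->.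
Qed.

(** The clauses are collected on the way to the refuted leaf, one for each split of two variables,
    the last being the refuting clause; [k] of them lie above the current node. A split assigns both
    variables, so the clauses found below it avoid them. *)
Lemma refuted_indep (F : cnf n) p ng k : clean p -> k <= 2 ->
  has_refuted (dtree F p ng k) ->
  exists D : cnf n, [/\ size D = 3 - k, indep (free_set p) D &
    forall a, sat_cnf a F -> sat_cnf a D].
Proof.
elim: F p ng k => [|C F IH] p ng k cp k2 //=; rewrite /node.
have := two_pending (C := C) cp; have := size_lits C false cp.1.
have := @is_val_lits C p false.
case: (lits C p false) => q st /= vq sq two.
have sub b : free_set (map (settle b) q) \subset free_set p.
  apply/subsetP => i; rewrite !inE nth_map_settle -vq.
  by case: (nth _ _ _).
have ind p' (ng' : bool) : clean p' -> free_set p' \subset free_set p ->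
    has_refuted (dtree F p' ng' k) ->
  exists D : cnf n, [/\ size D = 3 - k, indep (free_set p) D &
    forall a, sat_cnf a (C :: F) -> sat_cnf a D].
  move=> cp' sp' /(IH _ _ _ cp' k2)[D [sD iD HD]].
  exists D; split=> // [|a /andP[_ /HD] //]; exact: indep_sub iD.
have indb b ng' := ind (map (settle b) q) ng' (clean_settle b sq) (sub b).
case: st two => two; first exact: indb.
case: ifP => [_ /orP[|]|/negbT]; [exact: indb|exact: indb|rewrite -leqNgt => sC].
case: ifP => [/andP[q2 k1] _|nk].
  have [i [j [b [c [iV jV ij H _]]]]] := two sC erefl q2.
  (* The test [1 < k] together with [k <= 2] leaves [k = 2], so a single clause completes the
     three. *)
  exists [:: C]; split=> /=; first by rewrite (_ : k = 2) //; lia.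
    by exists i, j, b, c.
  by move=> a /andP[->].
move=> /split_tree_refuted[q' [[] [//= rf sq' vq' cq']]].
have cl' : clean q' by split; rewrite ?sq' ?cq' ?add0n.
have eV : free_set q' = free_set (map (settle true) q) by apply: eq_free_set.
case: (ltnP 1 (count is_pend q)) nk rf => [q2|q1] nk rf; last first.
  by rewrite addn0 in rf; apply: ind rf => //; rewrite eV.
have [i [j [b [c [iV jV ij H /andP[pi pj]]]]]] := two sC erefl q2.
have k1 : k + 1 <= 2 by move: nk; rewrite /=; lia.
have [D [sD iD HD]] := IH _ _ _ cl' k1 rf.
exists (C :: D); split=> /=; first by rewrite sD; lia.
  exists i, j, b, c; split=> //; apply: indep_sub iD.
  apply/subsetP => l lq; rewrite eV in lq; rewrite 2!in_setD1 (subsetP (sub true)) //.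
  move: lq; rewrite inE nth_map_settle andbT => lq; apply/andP; split.
    by apply: contraNneq lq => ->; case: (nth _ _ j) pj.
  by apply: contraNneq lq => ->; case: (nth _ _ i) pi.
by move=> a /andP[-> /HD].
Qed.
End Counting.

(** * Size of the tree and value of the counter *)

Lemma clean_rev n d : count is_pend d = 0 -> size d + 0 = n -> clean n (rev d).
Proof. by rewrite addn0 => cd sd; split; rewrite ?size_rev ?count_rev. Qed.

(** Only the branch that falsifies every literal dies, and only when no literal was true before
    ([~~ o]); it counts for one leaf instead of [M]. *)
Lemma leaves_split n (K : seq wsym -> tree) M d q o : 0 < M ->
  (forall q', clean n q' -> leaves (K q') <= M) ->
  count is_pend d = 0 -> size d + size q = n ->
  leaves (split_tree d q o (fun q' o' => if o' then K q' else Leaf Dead))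
  <= (2 ^ count is_pend q - ~~ o) * M + ~~ o.
Proof.
move=> M0 HK; elim: q d o => [|w q IH] d o cd sz.
  case: o => //=; rewrite subn0 mul1n addn0; apply: HK.
  exact: clean_rev.
have sz' x : size (x :: d) + size q = n by rewrite -sz /= addSnnS.
case: w {sz} => [|v|v] /=; try exact: IH.
have := IH (Val (~~ v) :: d) true cd (sz' _); have := IH (Val v :: d) o cd (sz' _).
rewrite add1n expnS; have : 0 < 2 ^ count is_pend q by rewrite expn_gt0.
by case: o => /=; nia.
Qed.

Lemma depth_split n (K : seq wsym -> bool -> tree) M d q o :
  (forall q' o', clean n q' -> depth (K q' o') <= M) ->
  count is_pend d = 0 -> size d + size q = n ->
  depth (split_tree d q o K) <= count is_pend q + M.
Proof.
move=> HK; elim: q d o => [|w q IH] d o cd sz.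
  by apply: HK; apply: clean_rev.
have sz' x : size (x :: d) + size q = n by rewrite -sz /= addSnnS.
case: w {sz} => [|v|v] /=; try exact: IH.
by rewrite ltnS geq_max !IH.
Qed.

Lemma count_pend_lits n (C : clause n) p st : size p = n ->
  count is_pend (lits C p st).1 <= count is_pend p + size C.
Proof.
elim: C p st => [|l C IH] p st sp /=; first by rewrite addn0.
have := count_pend_litw l sp; have := size_set_var l.1 (litw l.2 (nth Free p l.1)).1 sp.
case: (litw _ _) => w t /= sp' e; apply: leq_trans (IH _ _ sp') _.
by rewrite e; case: is_free => /=; lia.
Qed.

Definition long n (C : clause n) : bool := 2 < size C.

(** A long clause doubles the bound. A split of two variables multiplies it by at most 4, but raises
    [k] and so lowers the exponent by 2. Any other short clause adds at most one dead leaf, which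
    the factor [(size F).+1] absorbs. *)
Lemma leaves_dtree n (F : cnf n) p ng k : clean n p ->
  leaves (dtree F p ng k)
  <= (size F).+1 * 2 ^ (count (@long n) F + 2 * (2 - k)).
Proof.
elim: F p ng k => [|C F IH] p ng k cp; first by rewrite muln_gt0 expn_gt0.
rewrite [dtree _ _ _ _]/= /node.
have := size_lits C false cp.1; have := count_pend_lits C false cp.1.
case: (lits C p false) => q st /= cq sq; rewrite cp.2 add0n in cq.
have cs b := clean_settle b sq.
set e := count _ F; rewrite -/(long C).
have le1 (l : bool) x : x <= (size F).+1 * 2 ^ (e + 2 * (2 - k)) ->
    x <= (size F).+2 * 2 ^ (l + e + 2 * (2 - k)).
  by move=> h; rewrite -addnA expnD; case: (l); rewrite ?expn1 ?expn0; nia.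
case: st; first by apply: le1; apply: IH.
case: ifP => lC.
  rewrite /= -addnA add1n expnS.
  have := IH _ ng k (cs false); have := IH _ (~~ ng) k (cs true); rewrite -/e; nia.
move/negbT: lC; rewrite -leqNgt => sC.
have c2 : count is_pend q <= 2 by lia.
rewrite add0n.
case: ifP => [_|nk]; first by rewrite muln_gt0 expn_gt0.
pose M := (size F).+1 * 2 ^ (e + 2 * (2 - (k + (1 < count is_pend q)))).
have M0 : 0 < M by rewrite muln_gt0 expn_gt0.
have := @leaves_split n (fun q' => dtree F q' ng (k + (1 < count is_pend q))) M
  [::] q false M0 (fun q' cq' => IH q' _ _ cq') erefl sq.
move=> /leq_trans; apply; rewrite /M.
case: (ltnP 1 (count is_pend q)) nk => [q2|q1] /= nk.
  have -> : count is_pend q = 2 by lia.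
  have -> : e + 2 * (2 - k) = 2 + (e + 2 * (2 - (k + 1))) by lia.
  rewrite (expnD 2 2); have := expn_gt0 2 (e + 2 * (2 - (k + 1))); nia.
rewrite addn0; have := expn_gt0 2 (e + 2 * (2 - k)).
by case: (count is_pend q) q1 => [|[]] //= _; rewrite ?expn0 ?expn1; nia.
Qed.

Lemma depth_dtree n (F : cnf n) p ng k : clean n p ->
  depth (dtree F p ng k) <= 2 * size F.
Proof.
elim: F p ng k => [|C F IH] p ng k cp //.
rewrite [dtree _ _ _ _]/= /node [size _]/=.
have := size_lits C false cp.1; have := count_pend_lits C false cp.1.
case: (lits C p false) => q st /= cq sq; rewrite cp.2 add0n in cq.
have cs b := clean_settle b sq.
case: st; first by have := IH _ ng k (cs false); lia.
case: ifP => lC.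
  by have := IH _ ng k (cs false); have := IH _ (~~ ng) k (cs true) => /=; lia.
case: ifP => [_|_] //.
have H q' o' : clean n q' -> depth (if o' then
    dtree F q' ng (k + (1 < count is_pend q)) else Leaf Dead) <= 2 * size F.
  by move=> cq'; case: o' => //; apply: IH.
have := @depth_split n _ _ [::] q false H erefl sq; lia.
Qed.

(** * The value of the counter *)

Fixpoint bits_val (A : seq bool) : nat :=
  if A is b :: A' then b + 2 * bits_val A' else 0.

Lemma bits_val_cat u v : bits_val (u ++ v) = bits_val u + 2 ^ size u * bits_val v.
Proof. by elim: u => [|b u IH] /=; rewrite ?mul1n // IH expnS; nia. Qed.

Lemma bits_val_lt A : bits_val A < 2 ^ size A.
Proof. by elim: A => //= b A IH; rewrite expnS; case: b => /=; lia. Qed.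

Lemma bits_val_nseq n : bits_val (nseq n false) = 0.
Proof. by elim: n => //= n ->. Qed.

Lemma top_bits n A : size A = n.+2 ->
  (let: (x, y) := foldl (fun (z : bool * bool) b => (b, z.1)) (false, false) A in x || y)
  = (2 ^ n <= bits_val A).
Proof.
case/lastP: A => [|A b1] //; rewrite size_rcons => -[].
case/lastP: A => [|A b0] //; rewrite size_rcons => -[sA].
rewrite !foldl_rcons /= -!cats1 -catA bits_val_cat sA /=.
have := bits_val_lt A; rewrite sA.
by case: b0; case: b1 => /= h; apply/esym; [nia|nia|nia|];
  apply/negbTE; rewrite -ltnNge; nia.
Qed.

Local Open Scope ring_scope.

(** A congruence modulo [2 ^ size A]: [z] accounts for the carry or borrow lost at the top. *)
Lemma bits_val_ripple ng A : exists z : int,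
  (bits_val (ripple ng A) : int)
  = (bits_val A : int) + (-1) ^+ ng + z * (2 ^ size A)%N%:Z.
Proof.
elim: A => [|b A [z IH]] /=.
  by exists (- (-1) ^+ ng); rewrite expn0; ring.
case: ifP => /eqP eb /=.
  exists z; rewrite expnS (PoszM 2) mulrCA eb; move: IH; set w := z * _.
  by case: (ng); rewrite ?expr1 ?expr0 /=; lia.
exists 0; rewrite mul0r.
by case: b eb; case: ng {IH} => //= _; rewrite ?expr1 ?expr0; lia.
Qed.

Lemma bits_val_add_leaf lf A : exists z : int,
  (bits_val (add_leaf lf A) : int)
  = (bits_val A : int) + leaf_value lf + z * (2 ^ size A)%N%:Z.
Proof.
case: lf => [||ng q] /=; try by exists 0; rewrite mul0r !addr0.
set c := count _ _; case: (leqP c (size A)) => cA; last first.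
  (* A weight beyond the top bit leaves the counter unchanged, which is correct because [2 ^ c] is
     then a multiple of the modulus. *)
  exists (- ((-1) ^+ ng * (2 ^ (c - size A))%N%:Z)).
  rewrite take_oversize ?drop_oversize ?cats0 //=; try exact: ltnW.
  have -> : (2 ^ c = 2 ^ (c - size A) * 2 ^ size A)%N.
    by rewrite -expnD subnK // ltnW.
  by rewrite PoszM; ring.
have [z IH] := bits_val_ripple ng (drop c A).
have eA : bits_val A = (bits_val (take c A) + 2 ^ c * bits_val (drop c A))%N.
  by rewrite -[A in LHS](cat_take_drop c) bits_val_cat size_takel.
exists z; rewrite eA bits_val_cat size_takel //.
rewrite !(PoszD (bits_val (take c A))) !(PoszM (2 ^ c)%N) IH size_drop.
have -> : (2 ^ size A = 2 ^ c * 2 ^ (size A - c))%N by rewrite -expnD subnKC.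
by rewrite PoszM; ring.
Qed.

Lemma bits_val_accum t A : exists z : int,
  (bits_val (accum t A) : int)
  = (bits_val A : int) + tree_sum t + z * (2 ^ size A)%N%:Z.
Proof.
elim: t A => [lf|t0 IH0 t1 IH1] A /=; first exact: bits_val_add_leaf.
have [z0 e0] := IH0 A; have [z1 e1] := IH1 (accum t0 A).
by exists (z0 + z1); rewrite e1 e0 size_accum; ring.
Qed.

Lemma modular_eq (x y m : nat) (z : int) : (x < m)%N -> (y < m)%N ->
  (x : int) = (y : int) + z * m%:Z -> x = y.
Proof.
move=> xm ym e; have z0 : z = 0 by nia.
by move: e; rewrite z0; lia.
Qed.

Lemma cube_all_free n : @cube n (nseq n Free) =1 xpredT.
Proof. by move=> a; apply/forallP => i; rewrite nth_nseq if_same. Qed.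

Lemma num_sat_in n (F : cnf n) :
  num_sat F = num_in (nseq n Free) (fun a => sat_cnf a F).
Proof.
by apply: eq_card => a; rewrite !inE cube_all_free.
Qed.

Lemma clean_all_free n : clean n (nseq n Free).
Proof. by split; rewrite ?size_nseq ?count_nseq. Qed.

Lemma majority_search n (F : cnf n) (T := dtree F (nseq n Free) false 0) :
  (0 < n)%N ->
  majority_sat (Formula F) = ~~ has_refuted T &&
    (let: (x, y) := foldl (fun z b => (b, z.1)) (false, false)
                      (accum T (nseq n.+1 false)) in x || y).
Proof.
move=> n0; rewrite /majority_sat [nvars _]/= [clauses _]/=; set A := accum T _.
have sA : size A = n.-1.+2 by rewrite size_accum size_nseq prednK.
case: (boolP (has_refuted T)) => rf /=.
  have [D [sD iD HD]] := refuted_indep (clean_all_free n) (leq0n 2) rf.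
  have := indep_bound iD (clean_all_free n) (subxx _); rewrite sD count_nseq mul1n.
  have : (num_sat F <= num_in (nseq n Free) (fun a => sat_cnf a D))%N.
    by rewrite num_sat_in; apply: num_in_sub => a _; apply: HD.
  have : (0 < 2 ^ n.-1)%N by rewrite expn_gt0.
  have -> : (2 ^ n = 2 * 2 ^ n.-1)%N by rewrite -expnS prednK.
  move: (2 ^ _)%N (num_in _ _) (num_sat F) => u v w ? ? h.
  (* Here [u] is half the number of assignments: 64 v <= 54 u with u > 0 gives v < u. *)
  have {}h : (64 * v <= 27 * (2 * u))%N := h.
  by apply/negbTE; rewrite -ltnNge; lia.
rewrite (top_bits sA); have [z] := bits_val_accum T (nseq n.+1 false).
rewrite -/A dtree_sum //; last exact: clean_all_free.
rewrite bits_val_nseq size_nseq add0r mul1r -num_sat_in => e.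
rewrite (modular_eq _ _ e) //.
  by have := bits_val_lt A; rewrite sA prednK.
(* There are at most [2 ^ n] models, fewer than the modulus [2 ^ n.+1], which turns the congruence
   into an equality. *)
have := max_card [pred a : {ffun 'I_n -> bool} | cube (nseq n Free) a && sat_cnf a F].
rewrite card_ffun card_bool card_ord -/(num_in _ _) -num_sat_in expnS.
by have : (0 < 2 ^ n)%N by [rewrite expn_gt0]; lia.
Qed.

(** * Running time *)

Local Close Scope ring_scope.

Lemma encode_formulaE n (F : cnf n) :
  [seq scell s | s <- encode_formula (Formula F)] = nseq n (scell Tick) ++ code F.
Proof.
rewrite map_cat map_nseq /code map_flatten -map_comp; congr (_ ++ flatten _).
by apply: eq_map => C /=; rewrite map_flatten -map_comp.
Qed.

Lemma width_code n (F : cnf n) : width F <= size (code F).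
Proof.
rewrite size_flatten /shape -map_comp /width; elim: F => //= C F IH.
apply: leq_add => //; rewrite ltnS size_flatten /shape -map_comp.
elim: C => //= l C IHC; rewrite -add1n; apply: leq_add => //.
Qed.

Lemma size_width n (F : cnf n) : size F <= width F.
Proof. by elim: F => //= C F IH; rewrite /width /= -add1n leq_add. Qed.

(** [N] stands for the input length, [B] for the cost of a branch and [T] for the number of leaves.
    They satisfy [B] = O(N^2) and [T] = O(N^(K+1)), whence the exponent [3 + K]; [2 ^ 15] covers the
    product 32 * 100 of the constants and the lower-order terms. *)
Lemma run_time_le n w m l d T B N K r :
  0 < n -> n + m = N -> w <= m -> l <= w -> d <= 2 * l ->
  T <= l.+1 * 2 ^ (r + 2 * 2) -> 2 ^ r <= n ^ K ->
  B = 9 * n.+1 * w + 2 * m + 8 * n + 4 * d + 30 ->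
  6 * n + 8 + (T * B.+1 + 1 + (2 * n.+1).+1) <= 2 ^ 15 * N ^ (3 + K).
Proof.
move=> n0 nm wm lw dl TT rK eB.
have N1 : 0 < N by lia.
have BN : B.+1 <= 100 * N ^ 2.
  have w1 : n * w <= N * N by apply: leq_mul; lia.
  have w2 : N <= N * N by rewrite leq_pmulr.
  by rewrite eB -mulnn; lia.
have TN : T <= 32 * N ^ K.+1.
  have nK : 2 ^ r <= N ^ K.
    apply: leq_trans rK _; case: (posnP K) => [->|K0] //.
    by rewrite leq_exp2r //; lia.
  have lN : l.+1 <= 2 * N by lia.
  apply: leq_trans TT _; apply: leq_trans (leq_mul lN (leqnn _)) _.
  by rewrite expnD (expnS N); move: nK; rewrite -[2 ^ (2 * 2)]/16; nia.
have NK : 0 < N ^ K by rewrite expn_gt0 N1.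
have TB : T * B.+1 <= 3200 * N ^ (3 + K).
  apply: leq_trans (leq_mul TN BN) _.
  by rewrite (expnS N) (expnD N 3) (expnS N 2); nia.
have N3 : N <= N ^ (3 + K) by rewrite -{1}(expn1 N) leq_pexp2l.
have e5 : 2 ^ 5 = 32 by [].
rewrite (expnD 2 5 10) (expnD 2 5 5) e5.
lia.
Qed.

(** For [N >= 2] the constant is at most [N ^ A] and goes into the exponent; for [N = 1] the
    additive [k] pays for it. *)
Lemma exp_bound (A e N k : nat) : 0 < N -> 2 ^ A + A + e <= k ->
  2 ^ A * N ^ e <= N ^ k + k.
Proof.
move=> N0 hk; case: (leqP N 1) => N1.
  by have -> : N = 1 by [lia]; rewrite !exp1n muln1; lia.
apply: leq_trans (leq_addr _ _).
apply: (@leq_trans (N ^ (A + e))); last by apply: leq_pexp2l => //; lia.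
rewrite expnD leq_mul2r; apply/orP; right.
by case: (posnP A) => [->|A0] //; rewrite leq_exp2r.
Qed.

Local Open Scope ring_scope.

Lemma pow2_log (R : realType) (c : R) (K n r : nat) : (0 < n)%N ->
  c <= K%:R -> r%:R <= c * log2 n%:R -> (2 ^ r <= n ^ K)%N.
Proof.
move=> n0 cK; rewrite /log2 => h.
have ln2 : 0 < ln 2 :> R by rewrite ln_gt0 // ltr1n.
have lnn : 0 <= ln n%:R :> R by rewrite ln_ge0 // ler1n.
have {}h : r%:R * ln 2 <= K%:R * ln n%:R :> R.
  rewrite -ler_pdivlMr // -mulrA; apply: le_trans h _.
  by apply: ler_wpM2r => //; rewrite divr_ge0 // ltW.
rewrite -(ler_nat R) !natrX -ler_ln ?posrE ?exprn_gt0 ?ltr0n //.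
by rewrite !lnXn ?ltr0n // -![ln _ *+ _]mulr_natl.
Qed.

Lemma long_2cnf n (G : cnf n) : is_2cnf G -> count (@long n) G = 0%N.
Proof. by elim: G => //= C G IH /andP[sC /IH ->]; rewrite /long ltnNge sC. Qed.

Theorem theorem7p3 (R : realType) (c : R) (hc : 0 < c) :
  poly_time_decidable encode_formula (two_cnf_plus_log_clauses c) majority_sat.
Proof.
pose K := Num.bound c; have cK : c <= K%:R by apply/ltW/archi_boundP/ltW.
(* One machine serves every [c]; only the exponent of the time bound depends on [c], through [K]. *)
exists (compile main_prog (regs false false 0 false false) answer).
exists (2 ^ 15 + 15 + (3 + K))%N => -[n F] [/= n0 [G [Cs [eF G2 sCs]]]].
(* Long clauses can only come from [Cs], so the logarithmic bound on [size Cs] also bounds their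
   number. *)
have rK : (2 ^ count (@long n) F <= n ^ K)%N.
  apply: (pow2_log (c := c)) => //; apply: le_trans sCs.
  by rewrite eF count_cat long_2cnf // ler_nat count_size.
have [m' [E e]] := main_ex F.
rewrite (majority_search F n0) -e; apply: compile_answers.
rewrite encode_formulaE; apply: exec_le E.
have sN : (n + size (code F))%N = size (encode_formula (Formula F)).
  by rewrite -(size_map scell) encode_formulaE size_cat size_nseq.
have N0 : (0 < size (encode_formula (Formula F)))%N by rewrite -sN ltn_addr.
apply: leq_trans (exp_bound N0 (leqnn _)).
apply: run_time_le n0 sN (width_code F) (size_width F) _ _ rK erefl.
  exact: depth_dtree (clean_all_free n).
exact: leaves_dtree (clean_all_free n).
Qed.
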